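(* Let $\mathbf{X}_1,\ldots,\mathbf{X}_n$ be i.i.d. random positive semidefinite $d\times d$ matrices such that, for some $L>0$, $\mathbf{0}\preceq\mathbf{X}_1\preceq L\mathbf{I}$ almost surely. Let $\mathbf{S}_n=\sum_{i=1}^n\mathbf{X}_i$. Assume that $\lambda_{\min}(\mathbb{E}\mathbf{S}_n)>0$ and that $\mathbb{E}\mathbf{S}_n$ is not a scalar multiple of the identity, and let $\kappa=\|\mathbb{E}\mathbf{S}_n\|/\lambda_{\min}(\mathbb{E}\mathbf{S}_n)$. Then, for any $0<\varepsilon<1$, $$\mathbb{P}\big(\lambda_{\min}(\mathbf{S}_n)\le(1-\varepsilon)\lambda_{\min}(\mathbb{E}\mathbf{S}_n)\big)\le\tilde d_{\min}\left(\frac{e^{-\varepsilon}}{(1-\varepsilon)^{1-\varepsilon}}\right)^{\frac{n\lambda_{\min}(\mathbb{E}\mathbf{X}_1)}{L}},$$ where $$\tilde d_{\min}=\underline{\dim}(\mathbb{E}\mathbf{S}_n)+\overline{\dim}(\mathbb{E}\mathbf{S}_n)\,e^{-n\varepsilon\lambda_{\min}(\mathbb{E}\mathbf{X}_1)(\kappa-1)/L},$$ and $$\mathbb{P}\big(\|\mathbf{S}_n\|\ge(1+\varepsilon)\|\mathbb{E}\mathbf{S}_n\|\big)\le\tilde d_{\max}\left(\frac{e^{\varepsilon}}{(1+\varepsilon)^{1+\varepsilon}}\right)^{\frac{n\|\mathbb{E}\mathbf{X}_1\|}{L}},$$ where $$\tilde d_{\max}=\overline{\dim}(\mathbb{E}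\mathbf{S}_n)+\underline{\dim}(\mathbb{E}\mathbf{S}_n)\,e^{-n\varepsilon\|\mathbb{E}\mathbf{X}_1\|(1-\kappa^{-1})/L}.$$
   Context: $\|\cdot\|$ is the spectral (operator) norm, $\lambda_{\min}$ the smallest eigenvalue, $\mathbf{I}$ the $d\times d$ identity, and $\mathbf{A}\preceq\mathbf{B}$ means that $\mathbf{B}-\mathbf{A}$ is positive semidefinite. For a $d\times d$ positive semidefinite matrix $\mathbf{A}$ that is not a scalar multiple of $\mathbf{I}$, the upper and lower intrinsic dimensions are $$\overline{\dim}(\mathbf{A})=\frac{\operatorname{tr}(\mathbf{A}-\lambda_{\min}(\mathbf{A})\mathbf{I})}{\|\mathbf{A}\|-\lambda_{\min}(\mathbf{A})},\qquad \underline{\dim}(\mathbf{A})=\frac{\operatorname{tr}(\|\mathbf{A}\|\mathbf{I}-\mathbf{A})}{\|\mathbf{A}\|-\lambda_{\min}(\mathbf{A})}=d-\overline{\dim}(\mathbf{A}).$$ *)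

(* Defs.v *)
From HB Require Import structures.
From mathcomp Require Import all_boot all_order all_algebra.
From mathcomp Require Import complex.
From mathcomp Require Import all_classical all_reals all_analysis.

Set Implicit Arguments.
Unset Strict Implicit.
Unset Printing Implicit Defensive.

Import Order.TTheory GRing.Theory Num.Theory.

Local Open Scope classical_set_scope.
Local Open Scope ring_scope.
Local Open Scope complex_scope.

Section matrices.
Context {R : realType} {d : nat}.
Implicit Types (A B : 'M[R[i]]_d) (v : 'cV[R[i]]_d).

(* The order of R[i] is partial: 0 <= z says that z is real and nonnegative. *)
Definition psdmx A : Prop :=
  A \is hermsymmx /\
  forall v, 0 <= ((map_mx Num.conj v)^T *m A *m v) 0 0.

Definition loewner_le A B : Prop := psdmx (B - A).

Definition l2norm v : R := Num.sqrt (\sum_(i < d) (Normc.normc (v i 0)) ^+ 2).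

(* On a Hermitian matrix with 0 < d the set is finite and nonempty, so that
   inf is its minimum. *)
Definition lambda_min A : R := inf [set x : R | eigenvalue A x%:C].

Definition opnorm A : R := sup [set l2norm (A *m v) | v in [set v | l2norm v <= 1]].

(* The traces below are real when A is Hermitian. *)
Definition upper_dim A : R :=
  complex.Re (\tr (A - ((lambda_min A)%:C)%:M)) / (opnorm A - lambda_min A).

Definition lower_dim A : R :=
  complex.Re (\tr (((opnorm A)%:C)%:M - A)) / (opnorm A - lambda_min A).

End matrices.

(* g_sigma_algebraType requires a pointed carrier. *)
HB.instance Definition _ (R : rcfType) := isPointed.Build R[i] 0.

(* Preimages of Borel sets of R under the real and imaginary parts of the
   entries; they generate the Borel sigma-algebra of the complex matrices. *)
Definition mx_cylinders (R : realType) (d : nat) : set (set 'M[R[i]]_d) :=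
  [set A | exists (i j : 'I_d) (B : set R), measurable B /\
     (A = [set M : 'M[R[i]]_d | B (complex.Re (M i j))] \/
      A = [set M : 'M[R[i]]_d | B (complex.Im (M i j))])].

Definition borel_mx (R : realType) (d : nat) :=
  g_sigma_algebraType (@mx_cylinders R d).

Section random_matrices.
Context {disp : measure_display} {T : measurableType disp} {R : realType}.
Context (P : probability T R).

Definition mx_expectation {d : nat} (Y : T -> 'M[R[i]]_d) : 'M[R[i]]_d :=
  \matrix_(i, j) (fine ('E_P[fun t => complex.Re (Y t i j)]) +i*
                  fine ('E_P[fun t => complex.Im (Y t i j)])).

Definition mutually_independent {n : nat} {disp' : measure_display}
    {T' : measurableType disp'} (X : 'I_n -> {RV P >-> T'}) : Prop :=
  forall (J : {set 'I_n}) (B : 'I_n -> set T'),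
    (forall i, measurable (B i)) ->
    P (\bigcap_(i in [set` J]) (X i @^-1` B i)) =
    (\prod_(i in J) P (X i @^-1` B i))%E.

Definition identically_distributed {n : nat} {disp' : measure_display}
    {T' : measurableType disp'} (X : 'I_n -> {RV P >-> T'}) : Prop :=
  forall (i j : 'I_n) (B : set T'), measurable B ->
    distribution P (X i) B = distribution P (X j) B.

Definition mx_sum {n d : nat} (X : 'I_n -> {RV P >-> borel_mx R d}) (t : T) :
  'M[R[i]]_d := \sum_(i < n) (X i t : 'M[R[i]]_d).

End random_matrices.

(* Main.v *)
From HB Require Import structures.
Require Import Defs.
From mathcomp Require Import all_boot all_order all_algebra.
From mathcomp Require Import complex.
From mathcomp Require Import all_classical all_reals all_analysis.
From mathcomp Require Import measurable_realfun sesquilinear spectral ring lra.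

(* Laplace transform method with Lieb's concavity theorem in the form of a
   supporting hyperplane. Joint convexity of the relative entropy
   D(T, A) = tr T (ln T - ln A) comes from
     t ln (t / a) = \int_0^1 t (t - a) / ((1 - w) t + w a) dw,
   since w times the integrand plus t is t^2 / ((1 - w) t + w a), for matrices the
   supremum over Z of 2 Re tr(Z^H T) - (1 - w) tr(Z^H T Z) - w tr(Z A Z^H), which
   is linear in (T, A) for fixed Z. Choosing Z optimal at one base point and
   integrating over w gives the tangent inequality. At the base point
   (exp(H + g E X), 1 + g E X), with e^(th x) <= 1 + g x on [0, L], it yields
   E tr exp(H + th X) <= tr exp(H + g E X). Peeling off the independent summands
   one at a time gives E tr exp(th S) <= tr exp(g E S), and bounding e^x by its
   chord over the spectrum of E S brings in the two intrinsic dimensions. *)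

Set Implicit Arguments.
Unset Strict Implicit.
Unset Printing Implicit Defensive.

Import Order.TTheory GRing.Theory Num.Theory.
Import numFieldNormedType.Exports.

Local Open Scope classical_set_scope.
Local Open Scope ring_scope.
Local Open Scope complex_scope.
Local Open Scope sesquilinear_scope.

(** * Spectral calculus of Hermitian matrices *)

Section complex_matrices.
Context {R : realType}.
Implicit Types z w : R[i].

(** Every Hermitian matrix is handled as [fcal U f], so two of them meet only through the overlaps
    [csq ((U *m V^H) a b)], a doubly stochastic array. The integral over w then reduces to finite
    sums of explicit scalar functions of w. It is never formed as an integral: antiderivatives and
    the sign of a derivative suffice, and the factor 1/w is avoided by working with w times the
    derivative. The hyperplane form replaces concavity plus Jensen because its right side is affine
    in X: entrywise expectations are enough, and equality at the base point returns exactly the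
    wanted trace. Eigenvalues are not chosen measurably. Events about them are rewritten as
    countably many conditions on tr exp, which is a limit of polynomials in the real and imaginary
    parts of the entries. The values th = ln(1 + eps) / L and th = ln(1 - eps) / L minimize the
    leading exponent of each tail and turn the chord slope g into eps / L and - eps / L. *)

Lemma ReD z w : complex.Re (z + w) = complex.Re z + complex.Re w.
Proof. by case: z w => [a b] [c e]. Qed.

Lemma ReB z w : complex.Re (z - w) = complex.Re z - complex.Re w.
Proof. by case: z w => [a b] [c e]. Qed.

Lemma ImD z w : complex.Im (z + w) = complex.Im z + complex.Im w.
Proof. by case: z w => [a b] [c e]. Qed.

Lemma Re_sum (I : Type) (r : seq I) (Q : pred I) (F : I -> R[i]) :
  complex.Re (\sum_(i <- r | Q i) F i) = \sum_(i <- r | Q i) complex.Re (F i).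
Proof. exact: (big_morph _ ReD erefl). Qed.

Lemma Im_sum (I : Type) (r : seq I) (Q : pred I) (F : I -> R[i]) :
  complex.Im (\sum_(i <- r | Q i) F i) = \sum_(i <- r | Q i) complex.Im (F i).
Proof. exact: (big_morph _ ImD erefl). Qed.

Lemma ReZl (a : R) z : complex.Re (a%:C * z) = a * complex.Re z.
Proof. by case: z => x y /=; rewrite mul0r subr0. Qed.

Lemma ReZr (a : R) z : complex.Re (z * a%:C) = complex.Re z * a.
Proof. by rewrite mulrC ReZl mulrC. Qed.

Lemma ImZl (a : R) z : complex.Im (a%:C * z) = a * complex.Im z.
Proof. by case: z => x y /=; rewrite mul0r addr0. Qed.

Lemma Re_conjc z : complex.Re (z^*)%R = complex.Re z.
Proof. by case: z. Qed.

Lemma Im_conjc z : complex.Im (z^*)%R = - complex.Im z.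
Proof. by case: z. Qed.

Lemma conj_realC (a : R) : ((a%:C)^*)%R = a%:C.
Proof. exact: conjc_real. Qed.

(** Squared modulus as an element of [R]; the norm of [R[i]] takes its values in [R[i]]. *)
Definition csq z : R := complex.Re z ^+ 2 + complex.Im z ^+ 2.

Lemma csq_ge0 z : 0 <= csq z.
Proof. by rewrite addr_ge0 ?sqr_ge0. Qed.

Lemma mulCconj z : z * (z^*)%R = (csq z)%:C.
Proof. by rewrite -normCK -add_Re2_Im2. Qed.

Lemma csq_conj z : csq (z^*)%R = csq z.
Proof. by case: z => a b; rewrite /csq /= sqrrN. Qed.

Lemma csq_normc z : csq z = Normc.normc z ^+ 2.
Proof. by case: z => a b; rewrite /csq /= sqr_sqrtr// addr_ge0 ?sqr_ge0. Qed.

Fact adj_key : unit. Proof. exact: tt. Qed.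
(* Locked, because unfolding conjugation on R[i] makes conversion very slow. *)
Definition adj m n (A : 'M[R[i]]_(m, n)) : 'M[R[i]]_(n, m) :=
  locked_with adj_key (A^t*).
Local Notation "A ^H" := (adj A) (at level 2, format "A ^H").

Lemma adjE m n (A : 'M[R[i]]_(m, n)) : A^H = A^t*.
Proof. by rewrite /adj unlock. Qed.

Section square.
Context {d : nat}.
Implicit Types (A B U V : 'M[R[i]]_d) (f g : 'I_d -> R).

Lemma adjK m n (A : 'M[R[i]]_(m, n)) : A^H^H = A.
Proof. by rewrite !adjE trmxCK. Qed.

Lemma adj_mxE m n (A : 'M[R[i]]_(m, n)) i j : A^H i j = (A j i)^*%R.
Proof. by rewrite adjE !mxE. Qed.

Lemma adjM n m p (A : 'M[R[i]]_(n, m)) (B : 'M[R[i]]_(m, p)) :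
  (A *m B)^H = B^H *m A^H.
Proof. by rewrite !adjE trmx_mul map_mxM. Qed.

Lemma adj_unitary U : (U^H \is unitarymx) = (U \is unitarymx).
Proof. by rewrite adjE trmxC_unitary. Qed.

Lemma unitaryKl U : U \is unitarymx -> U *m U^H = 1%:M.
Proof. by move/unitarymxP; rewrite adjE. Qed.

Lemma unitaryKr U : U \is unitarymx -> U^H *m U = 1%:M.
Proof.
by move=> Uu; rewrite adjE -invmx_unitary// mulVmx// unitarymx_unit.
Qed.

Lemma unitary_mul_adj U V :
  U \is unitarymx -> V \is unitarymx -> U *m V^H \is unitarymx.
Proof.
move=> Uu Vu.
exact: (mul_unitarymx Uu (etrans (adj_unitary V) Vu)).
Qed.

Definition rtr A : R := complex.Re (\tr A).

Lemma rtrD A B : rtr (A + B) = rtr A + rtr B.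
Proof. by rewrite /rtr raddfD ReD. Qed.

Lemma rtrB A B : rtr (A - B) = rtr A - rtr B.
Proof. by rewrite /rtr raddfB ReB. Qed.

Lemma rtrZ (a : R) A : rtr (a%:C *: A) = a * rtr A.
Proof. by rewrite /rtr linearZ /= ReZl. Qed.

Lemma rtrC A B : rtr (A *m B) = rtr (B *m A).
Proof. by rewrite /rtr mxtrace_mulC. Qed.

Definition dg f : 'M[R[i]]_d := diag_mx (\row_j (f j)%:C).

(** Serves both as spectral decomposition and as functional calculus: if A is [fcal U f], then
    phi(A) is [fcal U (phi \o f)]. The eigenbasis [U] is carried along explicitly. *)
Definition fcal U f : 'M[R[i]]_d := U^H *m dg f *m U.

Lemma dgD f g : dg f + dg g = dg (fun j => f j + g j).
Proof. by apply/matrixP => i j; rewrite !mxE -mulrnDl -rmorphD. Qed.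

Lemma dgZ (a : R) f : a%:C *: dg f = dg (fun j => a * f j).
Proof. by apply/matrixP => i j; rewrite !mxE mulrnAr -rmorphM. Qed.

Lemma dgc (a : R) : (a%:C)%:M = dg (fun=> a).
Proof. by apply/matrixP => i j; rewrite !mxE. Qed.

Lemma dgM f g : dg f *m dg g = dg (fun j => f j * g j).
Proof.
rewrite mulmx_diag; congr diag_mx; apply/rowP => j; rewrite !mxE.
by rewrite -rmorphM.
Qed.

Lemma dg_adj f : (dg f)^H = dg f.
Proof.
rewrite adjE /dg tr_diag_mx map_diag_mx; congr diag_mx; apply/rowP => j.
by rewrite mxE mxE; exact: conj_realC.
Qed.

Lemma fcalD U f g : fcal U f + fcal U g = fcal U (fun j => f j + g j).
Proof. by rewrite /fcal -mulmxDl -mulmxDr dgD. Qed.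

Lemma fcalZ U (a : R) f : a%:C *: fcal U f = fcal U (fun j => a * f j).
Proof. by rewrite /fcal -dgZ -scalemxAr -scalemxAl. Qed.

Lemma fcalB U f g : fcal U (fun j => f j - g j) = fcal U f - fcal U g.
Proof.
rewrite -[- fcal U g]scaleN1r -(rmorphN1 (real_complex R)) fcalZ fcalD.
by congr fcal; apply/funext => j; rewrite mulN1r.
Qed.

Lemma fcalc U (a : R) : U \is unitarymx -> (a%:C)%:M = fcal U (fun=> a).
Proof.
by move=> Uu; rewrite /fcal -dgc mul_mx_scalar -scalemxAl (unitaryKr Uu) scalemx1.
Qed.

Lemma fcalM U f g : U \is unitarymx ->
  fcal U f *m fcal U g = fcal U (fun j => f j * g j).
Proof.
move=> Uu; rewrite /fcal.
transitivity (U^H *m (dg f *m (U *m U^H) *m dg g) *m U).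
  by rewrite !mulmxA.
by rewrite (unitaryKl Uu) mulmx1 dgM.
Qed.

Lemma fcal_adj U f : (fcal U f)^H = fcal U f.
Proof. by rewrite /fcal !adjM dg_adj adjK mulmxA. Qed.

Lemma hermP A : reflect (A^H = A) (A \is hermsymmx).
Proof.
rewrite adjE; apply: (iffP (is_hermitianmxP _ _ _)); rewrite expr0 scale1r => /esym //.
Qed.

Lemma fcal_herm U f : fcal U f \is hermsymmx.
Proof. by apply/hermP/fcal_adj. Qed.

Lemma spectral_decomposition A : A \is hermsymmx ->
  exists U f, U \is unitarymx /\ A = fcal U f.
Proof.
move=> Ah; have Uu := spectral_unitarymx A.
exists (spectralmx A), (fun j => complex.Re (spectral_diag A 0 j)).
split=> //; have /orthomx_spectralP AE := hermitian_normalmx Ah.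
have E : diag_mx (spectral_diag A) =
         dg (fun j => complex.Re (spectral_diag A 0 j)).
  congr diag_mx; apply/rowP => j; rewrite mxE RRe_real//.
  by have /mxOverP := hermitian_spectral_diag_real Ah; exact.
by rewrite /fcal adjE -(invmx_unitary Uu) -E; exact: AE.
Qed.

Lemma rtr_fcal U f : U \is unitarymx -> rtr (fcal U f) = \sum_j f j.
Proof.
move=> Uu; rewrite /fcal rtrC mulmxA (unitaryKl Uu) mul1mx /rtr /mxtrace Re_sum.
by apply: eq_bigr => j _; rewrite !mxE eqxx.
Qed.

Lemma rtr_dg2 f g (A : 'M[R[i]]_d) :
  rtr (A^H *m dg f *m A *m dg g) = \sum_a \sum_b f a * g b * csq (A a b).
Proof.
rewrite exchange_big /= /rtr /mxtrace Re_sum; apply: eq_bigr => b _.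
rewrite mul_mx_diag !mxE ReZr Re_sum mulr_suml; apply: eq_bigr => a _.
rewrite mul_mx_diag !mxE adj_mxE mulrAC [X in X * _%:C]mulrC mulCconj -rmorphM /=.
by rewrite -[LHS]mulrA mulrC.
Qed.

(** The weight at (a, b) is the squared overlap of an eigenvector of the first matrix with one of
    the second. Rows and columns of these weights sum to 1, which reduces trace inequalities to
    scalar ones. *)
Lemma rtr_fcal2 U V f g :
  rtr (fcal U f *m fcal V g) =
  \sum_a \sum_b f a * g b * csq ((U *m V^H) a b).
Proof.
rewrite -rtr_dg2 adjM adjK /fcal !mulmxA rtrC !mulmxA.
by congr (rtr _); rewrite !mulmxA.
Qed.

Lemma unitary_row_csq U (a : 'I_d) : U \is unitarymx ->
  \sum_b csq (U a b) = 1.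
Proof.
move=> /unitaryKl /matrixP/(_ a a); rewrite !mxE eqxx.
move=> /(congr1 (@complex.Re _)) /=; rewrite Re_sum => <-.
by apply: eq_bigr => b _; rewrite adj_mxE mulCconj.
Qed.

Lemma unitary_col_csq U (b : 'I_d) : U \is unitarymx ->
  \sum_a csq (U a b) = 1.
Proof.
move=> Uu; rewrite -adj_unitary in Uu.
rewrite -(unitary_row_csq b Uu); apply: eq_bigr => a _.
by rewrite adj_mxE csq_conj.
Qed.

Lemma quad_fcal U f (v : 'cV[R[i]]_d) :
  ((map_mx Num.conj v)^T *m fcal U f *m v) 0 0 =
  (\sum_j f j * csq ((U *m v) j 0))%:C.
Proof.
rewrite map_trmx -adjE /fcal !mulmxA -mulmxA -adjM.
rewrite mul_mx_diag mxE rmorph_sum; apply: eq_bigr => j _.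
move: (U *m v) => w; rewrite [LHS]mulrC !mxE adj_mxE [X in _ * X]mulrC.
by rewrite mulrCA mulCconj -rmorphM.
Qed.

Lemma unitary_csq U (v : 'cV[R[i]]_d) : U \is unitarymx ->
  \sum_j csq ((U *m v) j 0) = \sum_j csq (v j 0).
Proof.
move=> Uu; apply: complexI.
have := quad_fcal U (fun=> 1) v; rewrite -fcalc// mulmx1.
under eq_bigr do rewrite mul1r.
move=> <-; rewrite !mxE rmorph_sum; apply: eq_bigr => j _.
by rewrite !mxE mulrC mulCconj.
Qed.

Lemma unitaryKv U (v : 'cV[R[i]]_d) : U \is unitarymx -> U *m (U^H *m v) = v.
Proof. by move=> Uu; rewrite mulmxA (unitaryKl Uu) mul1mx. Qed.

Lemma psdmx_eigen_ge0 U f : U \is unitarymx -> psdmx (fcal U f) ->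
  forall j, 0 <= f j.
Proof.
move=> Uu [_ +] j => /(_ (U^H *m delta_mx j 0)).
rewrite quad_fcal unitaryKv// ler0c (bigD1 j)//= big1 => [|k kj].
  by rewrite addr0 /csq !mxE !eqxx /= expr1n expr0n addr0 mulr1.
by rewrite /csq !mxE (negbTE kj)/= expr0n addr0 mulr0.
Qed.

Lemma psdmx_fcal U f : (forall j, 0 <= f j) -> psdmx (fcal U f).
Proof.
move=> f0; split; first exact: fcal_herm.
move=> v; rewrite quad_fcal ler0c sumr_ge0// => j _.
by rewrite mulr_ge0 ?csq_ge0.
Qed.

Lemma fcal_loewner_scalar U f (c : R) : U \is unitarymx ->
  loewner_le (fcal U f) (c%:C)%:M <-> forall j, f j <= c.
Proof.
move=> Uu; rewrite /loewner_le (fcalc _ Uu).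
rewrite -fcalB.
split=> [/(psdmx_eigen_ge0 Uu) h j|h]; first by rewrite -subr_ge0.
by apply: psdmx_fcal => j; rewrite subr_ge0.
Qed.

Lemma eigenvalue_fcal U f (x : R) : U \is unitarymx ->
  eigenvalue (fcal U f) x%:C <-> exists j, x = f j.
Proof.
move=> Uu; split=> [/eigenvalueP[v vE v0]|[j ->]].
  have wE : v *m U^H *m dg f = x%:C *: (v *m U^H).
    by rewrite scalemxAl -vE /fcal !mulmxA -[RHS]mulmxA (unitaryKl Uu) mulmx1.
  have /rV0Pn[j wj] : v *m U^H != 0.
    apply: contra v0 => /eqP w0.
    by rewrite -[v]mulmx1 -(unitaryKr Uu) mulmxA w0 mul0mx.
  exists j; apply: complexI; apply: (mulfI wj).
  by have /rowP/(_ j) := wE; rewrite mul_mx_diag !mxE => ->; rewrite mulrC.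
(* [eigenvalue] refers to row vectors, so the eigenvector is the j-th row of [U]. *)
apply/eigenvalueP; exists (delta_mx 0 j *m U).
  rewrite /fcal -2!mulmxA (mulmxA U) (unitaryKl Uu) mul1mx mulmxA scalemxAl.
  congr (_ *m _); apply/rowP => k; rewrite mul_mx_diag !mxE mulrC eqxx /=.
  by case: eqP => [->|]; rewrite ?mulr0 ?mulr1.
apply/negP => /eqP eU0.
have := mul0mx 1 (U^H); rewrite -{1}eU0 -mulmxA (unitaryKl Uu) mulmx1 => /rowP/(_ j)/eqP.
by rewrite !mxE !eqxx oner_eq0.
Qed.

(** The index [j0] witnesses 0 < d; otherwise the infimum would be taken over the empty set. *)
Lemma lambda_min_fcal U f (j0 : 'I_d) : U \is unitarymx ->
  exists2 j, lambda_min (fcal U f) = f j & forall k, f j <= f k.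
Proof.
move=> Uu; case: (arg_minP f (isT : xpredT j0)) => j _ jmin.
exists j => [|k]; last exact: jmin.
have lb : lbound [set x : R | eigenvalue (fcal U f) x%:C] (f j).
  by move=> x /= /(eigenvalue_fcal _ _ Uu)[k ->]; apply: jmin.
apply/eqP; rewrite eq_le; apply/andP; split.
  apply: ge_inf; first by exists (f j).
  by apply/(eigenvalue_fcal _ _ Uu); exists j.
apply: lb_le_inf => //; exists (f j).
by apply/(eigenvalue_fcal _ _ Uu); exists j.
Qed.

Lemma l2norm_sq (v : 'cV[R[i]]_d) : l2norm v ^+ 2 = \sum_i csq (v i 0).
Proof.
rewrite /l2norm sqr_sqrtr ?sumr_ge0//; last by move=> i _; exact: sqr_ge0.
by apply: eq_bigr => i _; rewrite csq_normc.
Qed.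

Lemma l2norm_ge0 (v : 'cV[R[i]]_d) : 0 <= l2norm v.
Proof. exact: sqrtr_ge0. Qed.

Lemma l2norm_unitary U (v : 'cV[R[i]]_d) : U \is unitarymx ->
  l2norm (U *m v) = l2norm v.
Proof.
move=> Uu; apply/eqP; rewrite -(@eqrXn2 _ 2) ?nnegrE ?l2norm_ge0//.
by rewrite !l2norm_sq unitary_csq.
Qed.

(** For nonnegative eigenvalues the operator norm is the largest one: unitary invariance reduces to
    [dg f], and the norm is attained at the eigenvector [U^H *m delta_mx j 0]. *)
Lemma opnorm_fcal U f (j0 : 'I_d) : U \is unitarymx -> (forall j, 0 <= f j) ->
  exists2 j, opnorm (fcal U f) = f j & forall k, f k <= f j.
Proof.
move=> Uu f0; case: (arg_maxP f (isT : xpredT j0)) => j _ jmax.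
exists j => [|k]; last exact: jmax.
have Uu' : U^H \is unitarymx by rewrite adj_unitary.
have ub : ubound [set l2norm (fcal U f *m v) | v in [set v | l2norm v <= 1]] (f j).
  move=> _ [v /= v1 <-]; rewrite /fcal -!mulmxA l2norm_unitary//.
  rewrite -(@ler_sqr _ _ (f j)) ?nnegrE ?l2norm_ge0//.
  rewrite l2norm_sq; set w := U *m v.
  have w1 : \sum_i csq (w i 0) <= 1.
    rewrite -l2norm_sq /w l2norm_unitary// -(expr1n _ 2).
    by rewrite ler_sqr ?nnegrE ?l2norm_ge0.
  apply: (@le_trans _ _ (f j ^+ 2 * \sum_i csq (w i 0))); last first.
    by rewrite ler_piMr ?sqr_ge0.
  rewrite mulr_sumr ler_sum// => i _; rewrite mul_diag_mx !mxE.
  rewrite csq_normc Normc.normcM exprMn -!csq_normc ler_wpM2r ?csq_ge0//.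
  rewrite /csq/= expr0n addr0 ler_sqr ?nnegrE//; exact: jmax.
have delta1 : l2norm (delta_mx j 0 : 'cV[R[i]]_d) ^+ 2 = 1.
  rewrite l2norm_sq (bigD1 j)//= big1 => [|k kj].
    by rewrite addr0 /csq !mxE !eqxx /= expr1n expr0n addr0.
  by rewrite /csq !mxE (negbTE kj)/= expr0n addr0.
have vj : [set l2norm (fcal U f *m v) | v in [set v | l2norm v <= 1]] (f j).
  exists (U^H *m delta_mx j 0) => /=.
    by rewrite l2norm_unitary// -ler_sqr ?nnegrE ?l2norm_ge0// delta1 expr1n.
  rewrite /fcal -!mulmxA unitaryKv// l2norm_unitary//.
  apply/eqP; rewrite -(@eqrXn2 _ 2) ?nnegrE ?l2norm_ge0//.
  have -> : dg f *m (delta_mx j 0 : 'cV_d) = (f j)%:C *: delta_mx j 0.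
    apply/colP => k; rewrite mul_diag_mx !mxE.
    by case: (k =P j) => [->|]; rewrite ?mulr0 ?mulr1.
  have -> : l2norm ((f j)%:C *: (delta_mx j 0 : 'cV[R[i]]_d)) ^+ 2 =
            f j ^+ 2 * l2norm (delta_mx j 0 : 'cV[R[i]]_d) ^+ 2.
    rewrite !l2norm_sq mulr_sumr; apply: eq_bigr => k _.
    by rewrite !mxE csq_normc Normc.normcM exprMn -!csq_normc /csq/= expr0n addr0.
  by rewrite delta1 mulr1.
apply/eqP; rewrite eq_le; apply/andP; split.
  by apply: ge_sup => //; exists (f j).
by apply: ub_le_sup => //; exists (f j).
Qed.

Fact trexp_key : unit. Proof. exact: tt. Qed.
(* As a power series in A, tr exp A visibly does not depend on an eigenbasis and is
   measurable in A. Junk unless the series converges, as it does for Hermitian A. *)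
Definition trexp A : R :=
  locked_with trexp_key (limn (series (fun k => rtr (A ^+ k) / k`!%:R))).

Lemma trexpE A : trexp A = limn (series (fun k => rtr (A ^+ k) / k`!%:R)).
Proof. by rewrite /trexp unlock. Qed.

Lemma fcal_exp U f k : U \is unitarymx ->
  fcal U f ^+ k = fcal U (fun j => f j ^+ k).
Proof.
move=> Uu; elim: k => [|k IH].
  by rewrite expr0 -(fcalc 1 Uu).
rewrite exprS IH; apply: (etrans (fcalM _ _ Uu)); congr fcal.
by apply/funext => j; rewrite exprS.
Qed.

(** The trace of the k-th power is the sum of the k-th powers of the eigenvalues, so the series
    splits into d scalar exponential series. *)
Lemma cvg_trexp U f : U \is unitarymx ->
  series (fun k => rtr (fcal U f ^+ k) / k`!%:R) @ \oo --> \sum_j expR (f j).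
Proof.
move=> Uu.
have -> : series (fun k => rtr (fcal U f ^+ k) / k`!%:R) =
          (fun N => \sum_j series (exp_coeff (f j)) N).
  apply/funext => N; rewrite /series /= exchange_big /=; apply: eq_bigr => k _.
  by rewrite fcal_exp// rtr_fcal// mulr_suml.
elim: (index_enum _) => [|j r IH].
  by under eq_fun do rewrite big_nil; rewrite big_nil; exact: cvg_cst.
under eq_fun do rewrite big_cons; rewrite big_cons.
by apply: cvgD IH; exact: is_cvg_series_exp_coeff.
Qed.

Lemma trexp_fcal U f : U \is unitarymx -> trexp (fcal U f) = \sum_j expR (f j).
Proof. by move=> Uu; rewrite trexpE; apply/cvg_lim => //; exact: cvg_trexp. Qed.

Lemma is_cvg_trexp A : A \is hermsymmx ->
  cvgn (series (fun k => rtr (A ^+ k) / k`!%:R)).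
Proof.
move=> /spectral_decomposition[U [f [Uu ->]]].
by apply/cvg_ex; exists (\sum_j expR (f j)); exact: cvg_trexp.
Qed.

Lemma trexp_ge0 A : A \is hermsymmx -> 0 <= trexp A.
Proof.
move=> /spectral_decomposition[U [f [Uu ->]]]; rewrite trexp_fcal//.
by rewrite sumr_ge0// => j _; rewrite expR_ge0.
Qed.

End square.
End complex_matrices.
Notation "A ^H" := (adj A) (at level 2, format "A ^H").

(** * Lieb's inequality *)

Section calculus.
Context {R : realType}.
Implicit Types (t m w : R).

Lemma is_derive_bigsum (I : Type) (r : seq I) (F : I -> R -> R) (x : R)
    (dF : I -> R) : (forall i, is_derive x 1 (F i) (dF i)) ->
  is_derive x 1 (fun w => \sum_(i <- r) F i w) (\sum_(i <- r) dF i).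
Proof.
move=> h; elim: r => [|i r IH].
  by rewrite big_nil; under eq_fun do rewrite big_nil; exact: is_derive_cst.
by rewrite big_cons; under eq_fun do rewrite big_cons; exact: is_deriveD.
Qed.

Lemma is_derive_cmull (f : R -> R) (c x df : R) : is_derive x 1 f df ->
  is_derive x 1 (fun w => c * f w) (c * df).
Proof. by move=> h; exact: (@is_deriveZ _ _ _ f c x 1 df h). Qed.

Lemma is_derive_sub (f g : R -> R) (x df dg : R) :
  is_derive x 1 f df -> is_derive x 1 g dg ->
  is_derive x 1 (fun w => f w - g w) (df - dg).
Proof. by move=> hf hg; exact: (@is_deriveB _ _ _ f g). Qed.

Definition lin t m w := (1 - w) * t + w * m.

Lemma lin_gt0 t m w : 0 < t -> 0 < m -> 0 <= w <= 1 -> 0 < lin t m w.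
Proof. by rewrite /lin => t0 m0 /andP[w0 w1]; nra. Qed.

Lemma is_derive_lin t m w : is_derive w 1 (lin t m) (m - t).
Proof.
by rewrite /lin; apply: is_derive_eq; rewrite /GRing.scale /=; ring.
Qed.

Lemma is_derive_ln_lin t m w : 0 < t -> 0 < m -> 0 <= w <= 1 ->
  is_derive w 1 (fun w => ln (lin t m w)) ((m - t) / lin t m w).
Proof.
move=> t0 m0 w01; rewrite mulrC.
have dln : is_derive (lin t m w) 1 (@ln R) (lin t m w)^-1.
  exact/is_derive1_ln/lin_gt0.
have dl := is_derive_lin t m w.
exact: (@is_derive1_comp _ (@ln R) (lin t m)).
Qed.

Lemma is_derive_w_lin t m w : 0 < t -> 0 < m -> 0 <= w <= 1 ->
  is_derive w 1 (fun w => w / lin t m w) (t / lin t m w ^+ 2).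
Proof.
move=> t0 m0 w01; have d0 := lin_gt0 t0 m0 w01.
have dV : is_derive w 1 (fun w => (lin t m w)^-1)
            (- (lin t m w) ^- 2 *: (m - t)).
  by apply: is_deriveV; [rewrite gt_eqF|exact: is_derive_lin].
apply: is_derive_eq.
rewrite /= /GRing.scale /=; have : lin t m w != 0 by rewrite gt_eqF.
by rewrite /lin => ?; field.
Qed.

Lemma is_derive_1w_lin t m w : 0 < t -> 0 < m -> 0 <= w <= 1 ->
  is_derive w 1 (fun w => (1 - w) / lin t m w) (- m / lin t m w ^+ 2).
Proof.
move=> t0 m0 w01; have d0 := lin_gt0 t0 m0 w01.
have dV : is_derive w 1 (fun w => (lin t m w)^-1)
            (- (lin t m w) ^- 2 *: (m - t)).
  by apply: is_deriveV; [rewrite gt_eqF|exact: is_derive_lin].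
apply: is_derive_eq.
rewrite /= /GRing.scale /=; have : lin t m w != 0 by rewrite gt_eqF.
by rewrite /lin => ?; field.
Qed.

(* Acoef and Tcoef are antiderivatives in w of the coefficients of A and T in the
   quadratic form evaluated at the optimal Z; coinciding eigenvalues turn a divided
   difference of ln (lin t m w) into a derivative. *)
Definition Acoef t m1 m2 w : R :=
  if m1 == m2 then t * (w / lin t m1 w)
  else t / (m1 - m2) * (ln (lin t m1 w) - ln (lin t m2 w)).

Lemma is_derive_Acoef t m1 m2 w : 0 < t -> 0 < m1 -> 0 < m2 -> 0 <= w <= 1 ->
  is_derive w 1 (Acoef t m1 m2) (t ^+ 2 / (lin t m1 w * lin t m2 w)).
Proof.
move=> t0 m10 m20 w01; rewrite /Acoef; have [<-|m12] := eqVneq m1 m2.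
  apply: (is_derive_eq (is_derive_cmull t (is_derive_w_lin t0 m10 w01))).
  by rewrite mulrA.
apply: (is_derive_eq (is_derive_cmull (t / (m1 - m2)) (is_derive_sub
  (is_derive_ln_lin t0 m10 w01) (is_derive_ln_lin t0 m20 w01)))).
have : lin t m1 w != 0 by rewrite gt_eqF// lin_gt0.
have : lin t m2 w != 0 by rewrite gt_eqF// lin_gt0.
have : m1 - m2 != 0 by rewrite subr_eq0.
by rewrite /lin => ? ? ?; field; apply/and3P; split.
Qed.

Lemma Acoef_increment t m : 0 < t -> 0 < m ->
  Acoef t m m 1 - Acoef t m m 0 = t / m.
Proof. by move=> t0 m0; rewrite /Acoef eqxx /lin subr0 subrr !mul0r mulr0 subr0 add0r !mul1r. Qed.

Definition Tcoef t1 t2 m w : R :=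
  if t1 == t2 then - ln (lin t1 m w) - t1 * ((1 - w) / lin t1 m w)
  else - (t1 - t2)^-1 * (t1 * ln (lin t1 m w) - t2 * ln (lin t2 m w)).

Definition dTcoef t1 t2 m w : R :=
  if t1 == t2 then - ((m - t1) / lin t1 m w) - t1 * (- m / lin t1 m w ^+ 2)
  else - (t1 - t2)^-1 *
    (t1 * ((m - t1) / lin t1 m w) - t2 * ((m - t2) / lin t2 m w)).

Lemma is_derive_Tcoef t1 t2 m w : 0 < t1 -> 0 < t2 -> 0 < m -> 0 <= w <= 1 ->
  is_derive w 1 (Tcoef t1 t2 m) (dTcoef t1 t2 m w).
Proof.
move=> t10 t20 m0 w01; rewrite /Tcoef /dTcoef; case: ifPn => _.
  apply: is_derive_sub; first exact/is_deriveN/is_derive_ln_lin.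
  exact/is_derive_cmull/is_derive_1w_lin.
apply: is_derive_cmull; apply: is_derive_sub.
  exact/is_derive_cmull/is_derive_ln_lin.
exact/is_derive_cmull/is_derive_ln_lin.
Qed.

(** With p = t / lin, the right side p1 + p2 - (1 - w) p1 p2 - 1 collects the coefficients of T in 2
    Re tr(Z^H T) - (1 - w) tr(Z^H T Z) - tr T. It vanishes at w = 0, which is why [dTcoef] itself
    stays regular there. *)
Lemma dTcoefE t1 t2 m w : 0 < t1 -> 0 < t2 -> 0 < m -> 0 <= w <= 1 ->
  w * dTcoef t1 t2 m w = t1 / lin t1 m w + t2 / lin t2 m w
    - (1 - w) * (t1 / lin t1 m w * (t2 / lin t2 m w)) - 1.
Proof.
move=> t10 t20 m0 w01; rewrite /dTcoef.
have d1 : lin t1 m w != 0 by rewrite gt_eqF// lin_gt0.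
have d2 : lin t2 m w != 0 by rewrite gt_eqF// lin_gt0.
case: ifPn => [/eqP e|t12].
  by rewrite -e in d2 *; move: d1; rewrite /lin => ?; field.
have : t1 - t2 != 0 by rewrite subr_eq0.
by move: d1 d2; rewrite /lin => ? ? ?; field; apply/and3P; split.
Qed.

(** First divided difference of x ln x, with its derivative ln x + 1 on the diagonal. *)
Definition Tcoef_const t1 t2 : R :=
  if t1 == t2 then ln t1 + 1 else (t1 - t2)^-1 * (t1 * ln t1 - t2 * ln t2).

Lemma Tcoef_increment t1 t2 m : 0 < t1 -> 0 < t2 -> 0 < m ->
  Tcoef t1 t2 m 1 - Tcoef t1 t2 m 0 = Tcoef_const t1 t2 - ln m.
Proof.
move=> t10 t20 m0; rewrite /Tcoef /Tcoef_const /lin subr0 subrr !mul1r !mul0r.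
rewrite !addr0 !add0r; case: ifPn => [_|t12]; first by field; rewrite gt_eqF.
by field; rewrite subr_eq0.
Qed.

End calculus.

(** * Relative entropy and its tangent plane *)

Section relative_entropy.
Context {R : realType} {d : nat}.
Implicit Types (A B C U V Z : 'M[R[i]]_d) (f g : 'I_d -> R).

Lemma rtrM A B : rtr (A *m B) = \sum_i \sum_j complex.Re (A j i * B i j).
Proof.
rewrite exchange_big /= /rtr /mxtrace Re_sum; apply: eq_bigr => i _.
by rewrite mxE Re_sum.
Qed.

Lemma rtr_adj A : rtr (A^H) = rtr A.
Proof.
by rewrite /rtr /mxtrace !Re_sum; apply: eq_bigr => i _; rewrite adj_mxE Re_conjc.
Qed.

Lemma rtr_mul_dg A f : rtr (A *m dg f) = \sum_a complex.Re (A a a) * f a.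
Proof.
rewrite /rtr /mxtrace Re_sum; apply: eq_bigr => a _.
by rewrite mul_mx_diag !mxE ReZr.
Qed.

Lemma rtr_fcal_congr A f :
  rtr (A^H *m dg f *m A) = \sum_a \sum_b f a * csq (A a b).
Proof.
have := rtr_dg2 f (fun=> 1) A; rewrite -dgc mulmx1 => ->.
by apply: eq_bigr => a _; apply: eq_bigr => b _; rewrite mulr1.
Qed.

Lemma rtr_unitary_conj V A : V \is unitarymx -> rtr (V *m A *m V^H) = rtr A.
Proof. by move=> Vu; rewrite rtrC mulmxA (unitaryKr Vu) mul1mx. Qed.

(** If F depends on k only, this is C diag(F) C^H. The dependence on i and j as well accommodates
    divided differences, as in derivatives of matrix functions. *)
Definition gram C (F : 'I_d -> 'I_d -> 'I_d -> R) : 'M[R[i]]_d :=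
  \matrix_(i, j) \sum_k C i k * (C j k)^* * (F i j k)%:C.

Lemma rtr_gram A C F :
  rtr (A *m gram C F) =
  \sum_i \sum_j \sum_k complex.Re (A j i * (C i k * (C j k)^*)) * F i j k.
Proof.
rewrite rtrM; apply: eq_bigr => i _; apply: eq_bigr => j _.
rewrite mxE mulr_sumr Re_sum; apply: eq_bigr => k _.
by rewrite mulrA ReZr.
Qed.

(** In the coordinates Y = U Z V^H all three traces split over the pairs (a, b). With C = U V^H and
    D = s f_a + w g_b, the gap in each entry times D is the square |f_a C_ab - D Y_ab|^2. *)
Lemma quadratic_le_perspective U V f g Z (s w : R) :
  U \is unitarymx -> V \is unitarymx ->
  (forall a, 0 < f a) -> (forall b, 0 < g b) -> 0 <= s -> 0 < w ->
  2 * rtr (Z^H *m fcal U f) - s * rtr (Z^H *m fcal U f *m Z)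
    - w * rtr (Z *m fcal V g *m Z^H) <=
  \sum_a \sum_b csq ((U *m V^H) a b) * (f a ^+ 2 / (s * f a + w * g b)).
Proof.
move=> Uu Vu f0 g0 s0 w0; pose Y := U *m Z *m V^H; pose C := U *m V^H.
have E1 : rtr (Z^H *m fcal U f) =
    \sum_a \sum_b complex.Re (C a b * (Y a b)^*) * f a.
  transitivity (rtr (C *m Y^H *m dg f)); last first.
    rewrite rtr_mul_dg; apply: eq_bigr => a _; rewrite mxE Re_sum mulr_suml.
    by apply: eq_bigr => b _; rewrite adj_mxE.
  have -> : C *m Y^H = U *m Z^H *m U^H.
    transitivity (U *m (V^H *m V) *m (Z^H *m U^H)).
      by rewrite /C /Y !adjM adjK !mulmxA.
    by rewrite (unitaryKr Vu) mulmx1 mulmxA.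
  by rewrite /fcal !mulmxA rtrC [RHS]rtrC !mulmxA rtrC !mulmxA.
have E2 : rtr (Z^H *m fcal U f *m Z) = \sum_a \sum_b f a * csq (Y a b).
  rewrite -rtr_fcal_congr -(rtr_unitary_conj _ Vu) /Y !adjM adjK /fcal.
  by rewrite !mulmxA.
have E3 : rtr (Z *m fcal V g *m Z^H) = \sum_a \sum_b g b * csq (Y a b).
  transitivity (rtr ((Y^H)^H *m dg g *m Y^H)).
    rewrite adjK -(rtr_unitary_conj _ Uu) /Y !adjM adjK /fcal.
    by rewrite !mulmxA.
  rewrite rtr_fcal_congr exchange_big; apply: eq_bigr => a _.
  by apply: eq_bigr => b _; rewrite adj_mxE csq_conj.
rewrite {}E1 {}E2 {}E3 !mulr_sumr -!sumrB; apply: ler_sum => a _.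
rewrite !mulr_sumr -!sumrB; apply: ler_sum => b _.
have D0 : 0 < s * f a + w * g b.
  by apply: ltr_wpDl; [rewrite mulr_ge0// ltW|rewrite mulr_gt0].
rewrite -/C [in leRHS]mulrA ler_pdivlMr// /csq.
move: (C a b) (Y a b) => [x y] [u v] /=.
have fa := f0 a; have gb := g0 b.
have : 0 <= (f a * x - u * (s * f a + w * g b)) ^+ 2 +
    (f a * y - v * (s * f a + w * g b)) ^+ 2 by rewrite addr_ge0 ?sqr_ge0.
move: D0; set D := (s * f a + w * g b) => D0; move=> h.
rewrite -subr_ge0; apply: (le_trans h); rewrite le_eqVlt; apply/orP; left; apply/eqP.
rewrite /D; ring.
Qed.

Section gram_resolvent.
Variables (U V : 'M[R[i]]_d) (t m : 'I_d -> R) (w : R).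
Hypotheses (Uu : U \is unitarymx) (Vu : V \is unitarymx).
Hypotheses (t0 : forall i, 0 < t i) (m0 : forall k, 0 < m k).
Hypothesis w01 : 0 <= w <= 1.

Let C := U *m V^H.
Let p i k := t i / lin (t i) (m k) w.
Let Y : 'M[R[i]]_d := \matrix_(i, k) (C i k * (p i k)%:C).

(** The optimal Z at the base point T = [fcal U t], A = [fcal V m]: it solves the Sylvester equation
    (1 - w) T Z + w Z A = T, which is diagonal in the coordinates Y. *)
Definition resolvent : 'M[R[i]]_d := U^H *m Y *m V.

Let Cu : C \is unitarymx.
Proof. by exact: unitary_mul_adj. Qed.

Let YE i k : Y i k = C i k * (p i k)%:C.
Proof. by rewrite mxE. Qed.

Let YHE k i : Y^H k i = (C i k)^* * (p i k)%:C.
Proof. by rewrite adj_mxE YE rmorphM; congr (_ * _); exact: conj_realC. Qed.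

(** This is [dTcoefE] entry by entry, once the identity matrix is written as C C^H. *)
Lemma gram_dTcoef :
  w%:C *: gram C (fun i j k => dTcoef (t i) (t j) (m k) w) =
  Y *m C^H + C *m Y^H - (1 - w)%:C *: (Y *m Y^H) - 1%:M.
Proof.
rewrite -(unitaryKl Cu); apply/matrixP => i j; rewrite !mxE !mulr_sumr.
rewrite -big_split -!sumrB; apply: eq_bigr => k _.
rewrite !YE !YHE adj_mxE.
have -> : w%:C * (C i k * (C j k)^* * (dTcoef (t i) (t j) (m k) w)%:C) =
   C i k * (C j k)^* * (w * dTcoef (t i) (t j) (m k) w)%:C.
  by rewrite rmorphM /=; ring.
rewrite dTcoefE// -!/(p _ _) !rmorphB !rmorphD !rmorphM !rmorph1 /=.
ring.
Qed.

Lemma gram_Acoef :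
  gram (C^H) (fun k l i =>
    t i ^+ 2 / (lin (t i) (m k) w * lin (t i) (m l) w)) = Y^H *m Y.
Proof.
apply/matrixP => k l; rewrite !mxE; apply: eq_bigr => i _.
rewrite YE YHE !adj_mxE.
have -> : t i ^+ 2 / (lin (t i) (m k) w * lin (t i) (m l) w) = p i k * p i l.
  rewrite /p; field.
  by apply/andP; split; rewrite gt_eqF// lin_gt0.
rewrite rmorphM /=; move: (C i l) (C i k) => x y.
by rewrite conjCK; ring.
Qed.

(** Here T is free: the optimal Z of the base point is tested on another Hermitian matrix. The term
    - tr T undoes the t that was added to w times the integrand. *)
Lemma rtr_gram_dTcoef (T : 'M[R[i]]_d) : T^H = T ->
  w * rtr ((U *m T *m U^H) *m gram C (fun i j k => dTcoef (t i) (t j) (m k) w))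
  = 2 * rtr (resolvent^H *m T) - (1 - w) * rtr (resolvent^H *m T *m resolvent)
    - rtr T.
Proof.
move=> Th; rewrite -rtrZ scalemxAr gram_dTcoef !mulmxBr mulmxDr !rtrB rtrD.
rewrite -scalemxAr rtrZ mulmx1 (rtr_unitary_conj _ Uu).
have -> : rtr (U *m T *m U^H *m (Y *m C^H)) = rtr (resolvent^H *m T).
  transitivity (rtr (U *m (T *m resolvent) *m U^H)).
    by rewrite /C adjM adjK /resolvent !mulmxA.
  by rewrite (rtr_unitary_conj _ Uu) -rtr_adj adjM Th.
have -> : rtr (U *m T *m U^H *m (C *m Y^H)) = rtr (resolvent^H *m T).
  transitivity (rtr (U *m T *m (U^H *m U) *m V^H *m Y^H)).
    by rewrite /C !mulmxA.
  rewrite (unitaryKr Uu) mulmx1 -!(mulmxA U) rtrC [RHS]rtrC /resolvent.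
  by rewrite !adjM adjK !mulmxA.
have -> : rtr (U *m T *m U^H *m (Y *m Y^H)) =
          rtr (resolvent^H *m T *m resolvent).
  transitivity (rtr (U *m (T *m (U^H *m Y *m (V *m V^H) *m Y^H *m U)) *m U^H)).
    rewrite (unitaryKl Vu) mulmx1 !mulmxA -(mulmxA _ U (U^H)) (unitaryKl Uu) mulmx1.
    by [].
  rewrite (rtr_unitary_conj _ Uu).
  transitivity (rtr (T *m (resolvent *m resolvent^H))).
    by rewrite /resolvent !adjM adjK !mulmxA.
  by rewrite mulmxA rtrC mulmxA.
by ring.
Qed.

Lemma rtr_gram_Acoef (A : 'M[R[i]]_d) :
  rtr ((V *m A *m V^H) *m gram (C^H) (fun k l i =>
    t i ^+ 2 / (lin (t i) (m k) w * lin (t i) (m l) w)))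
  = rtr (resolvent *m A *m resolvent^H).
Proof.
rewrite gram_Acoef rtrC [RHS]rtrC.
transitivity (rtr (V *m (A *m (V^H *m Y^H *m (U *m U^H) *m Y *m V)) *m V^H)).
  rewrite (unitaryKl Uu) mulmx1 [LHS]rtrC !mulmxA.
  by rewrite -(mulmxA _ V (V^H)) (unitaryKl Vu) mulmx1.
rewrite (rtr_unitary_conj _ Vu).
transitivity (rtr (A *m (resolvent^H *m resolvent))).
  by rewrite /resolvent !adjM adjK !mulmxA.
by rewrite rtrC mulmxA.
Qed.

End gram_resolvent.

(** Since C C^H = 1, the divided differences survive only on the diagonal, where they equal ln t +
    1. Integrating the coefficient of T thus gives ln T + 1 - ln A, written in the basis of T. *)
Lemma gram_Tcoef_const U V (t m : 'I_d -> R) (C := U *m V^H) :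
  U \is unitarymx -> V \is unitarymx ->
  gram C (fun i j k => Tcoef_const (t i) (t j) - ln (m k)) =
  dg (fun j => ln (t j) + 1) - C *m dg (fun k => ln (m k)) *m C^H.
Proof.
move=> Uu Vu; have Cu : C \is unitarymx by exact: unitary_mul_adj.
apply/matrixP => i j.
transitivity ((Tcoef_const (t i) (t j))%:C * (C *m C^H) i j -
   \sum_k C i k * (C j k)^* * (ln (m k))%:C).
  rewrite !mxE mulr_sumr -sumrB; apply: eq_bigr => k _.
  by rewrite adj_mxE rmorphB /=; ring.
rewrite (unitaryKl Cu) mul_mx_diag !mxE; congr (_ - _).
  rewrite /Tcoef_const; case: (i =P j) => [->|_]; last by rewrite mulr0.
  by rewrite eqxx mulr1.
apply: eq_bigr => k _.
by rewrite [X in _ = X * _]mxE [X in _ = _ * X * _]mxE adj_mxE mulrAC.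
Qed.

(** The left side is the tangent plane of D at the base point, evaluated at the primed pair; D is
    homogeneous of degree one, so the plane has no constant term. The matrix K is the derivative of
    ln at A applied to T, that is, minus the gradient of D in A. *)
Lemma relative_entropy_tangent U V (t m : 'I_d -> R) :
  U \is unitarymx -> V \is unitarymx ->
  (forall i, 0 < t i) -> (forall k, 0 < m k) ->
  exists2 K : 'M[R[i]]_d, rtr (K *m fcal V m) = \sum_i t i &
  forall U' V' (t' a' : 'I_d -> R), U' \is unitarymx -> V' \is unitarymx ->
    (forall i, 0 < t' i) -> (forall k, 0 < a' k) ->
    rtr (fcal U' t' *m (fcal U (fun j => ln (t j) + 1) - fcal V (fun j => ln (m j))))
      - rtr (fcal V' a' *m K)
    <= rtr (fcal U' t' *m (fcal U' (fun j => ln (t' j)) - fcal V' (fun j => ln (a' j)))).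
Proof.
move=> Uu Vu t0 m0; pose C := U *m V^H.
have Cu : C \is unitarymx by exact: unitary_mul_adj.
have Cu' : C^H \is unitarymx by rewrite adj_unitary.
pose G := gram (C^H) (fun k l i =>
  Acoef (t i) (m k) (m l) 1 - Acoef (t i) (m k) (m l) 0).
exists (V^H *m G *m V).
  transitivity (rtr (V^H *m (G *m (V *m V^H) *m dg m) *m V)).
    by rewrite /fcal !mulmxA.
  rewrite (unitaryKl Vu) mulmx1 rtrC mulmxA (unitaryKl Vu) mul1mx rtr_mul_dg.
  (* Only the diagonal entries of [G] count. There the integral of t^2 / lin^2 over [0, 1] is t / m,
     and the factor m cancels. *)
  transitivity (\sum_k \sum_i csq ((C^H) k i) * t i).
    apply: eq_bigr => k _; rewrite mxE Re_sum mulr_suml; apply: eq_bigr => i _.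
    rewrite ReZr mulCconj /= Acoef_increment// -mulrA divfK// gt_eqF//.
  rewrite exchange_big; apply: eq_bigr => i _; rewrite -mulr_suml.
  by rewrite unitary_col_csq// mul1r.
move=> U' V' t' a' Uu' Vu' t'0 a'0.
set T := fcal U' t'; set A := fcal V' a'.
pose C' := U' *m V'^H.
have Cu2 : C' \is unitarymx by exact: unitary_mul_adj.
pose al i j k := complex.Re ((U *m T *m U^H) j i * (C i k * (C j k)^*)).
pose be k l i := complex.Re ((V *m A *m V^H) l k *
                             ((C^H) k i * ((C^H) l i)^*)).
(* Antiderivative of the integrand of D at the primed pair minus the tangent form: [Phi 1 - Phi 0]
   is the gap between the two sides of the claim. *)
pose Phi w := \sum_a \sum_b csq (C' a b) * (- t' a * ln (lin (t' a) (a' b) w))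
  - (\sum_i \sum_j \sum_k al i j k * Tcoef (t i) (t j) (m k) w)
  + \sum_k \sum_l \sum_i be k l i * Acoef (t i) (m k) (m l) w.
pose dPhi w := \sum_a \sum_b
    csq (C' a b) * (- t' a * ((a' b - t' a) / lin (t' a) (a' b) w))
  - (\sum_i \sum_j \sum_k al i j k * dTcoef (t i) (t j) (m k) w)
  + \sum_k \sum_l \sum_i be k l i *
      (t i ^+ 2 / (lin (t i) (m k) w * lin (t i) (m l) w)).
have PhiD (w : R) : 0 <= w <= 1 -> is_derive w 1 Phi (dPhi w).
  move=> w01; apply: is_deriveD.
    apply: is_derive_sub; apply: is_derive_bigsum => i; apply: is_derive_bigsum => j.
      by apply: is_derive_cmull; apply: is_derive_cmull; exact: is_derive_ln_lin.
    by apply: is_derive_bigsum => k; apply: is_derive_cmull; exact: is_derive_Tcoef.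
  apply: is_derive_bigsum => i; apply: is_derive_bigsum => j.
  by apply: is_derive_bigsum => k; apply: is_derive_cmull; exact: is_derive_Acoef.
(* Multiplied by w, the derivative is the supremum over Z at the primed pair minus the value at the
   Z of the base point. The open interval suffices because [Phi] is continuous on [0, 1]. *)
have dPhi0 (w : R) : 0 < w -> w < 1 -> 0 <= dPhi w.
  move=> w0 w1; have w01 : 0 <= w <= 1 by rewrite !ltW.
  rewrite -(pmulr_rge0 _ w0) /dPhi.
  rewrite -(rtr_gram _ C) -(rtr_gram _ (C^H)).
  rewrite mulrDr mulrBr rtr_gram_dTcoef//; last exact: fcal_adj.
  rewrite rtr_gram_Acoef//; set Z := resolvent _ _ _ _ _.
  have := @quadratic_le_perspective U' V' t' a' Z (1 - w) w Uu' Vu' t'0 a'0.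
  rewrite subr_ge0 -/T -/A => /(_ (ltW w1) w0).
  (* The scalar identity w (integrand) + t = t^2 / lin, summed with weights whose rows add up to
     1. *)
  have -> : \sum_a \sum_b csq ((U' *m V'^H) a b) *
      (t' a ^+ 2 / ((1 - w) * t' a + w * a' b)) =
    w * (\sum_a \sum_b csq (C' a b) *
      (- t' a * ((a' b - t' a) / lin (t' a) (a' b) w))) + rtr T.
    have -> : rtr T = \sum_a \sum_b csq (C' a b) * t' a.
      rewrite rtr_fcal//; apply: eq_bigr => a _.
      by rewrite -mulr_suml unitary_row_csq// mul1r.
    rewrite mulr_sumr -big_split; apply: eq_bigr => a _ /=.
    rewrite mulr_sumr -big_split; apply: eq_bigr => b _ /=.
    have : lin (t' a) (a' b) w != 0 by rewrite gt_eqF// lin_gt0.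
    by rewrite /lin => ?; field.
  by lra.
have : Phi 0 <= Phi 1.
  have h01 : (0 : R) <= 1 by exact: ler01.
  apply: (@ger0_derive1_le_cc _ Phi 0 1) => //; rewrite ?in_itv/= ?lexx ?h01//.
  - move=> x /[!in_itv]/= /andP[x0 x1].
    by have [] := PhiD x; rewrite ?(ltW x0) ?(ltW x1).
  - move=> x /[!in_itv]/= /andP[x0 x1]; rewrite derive1E.
    have PhiDx : is_derive x 1 Phi (dPhi x) by apply: PhiD; rewrite !ltW.
    by rewrite derive_val dPhi0.
  - apply: derivable_within_continuous => x /[!in_itv]/= x01.
    by have [] := PhiD x x01.
rewrite -subr_ge0.
have -> : Phi 1 - Phi 0 =
    rtr (T *m (fcal U' (fun j => ln (t' j)) - fcal V' (fun j => ln (a' j))))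
  - rtr (T *m (fcal U (fun j => ln (t j) + 1) - fcal V (fun j => ln (m j))))
  + rtr (A *m (V^H *m G *m V)).
  have -> : rtr (A *m (V^H *m G *m V)) = rtr ((V *m A *m V^H) *m G).
    transitivity (rtr (V *m (A *m (V^H *m G *m V)) *m V^H)).
      by rewrite rtr_unitary_conj.
    transitivity (rtr (V *m A *m V^H *m G *m (V *m V^H))).
      by rewrite !mulmxA.
    by rewrite (unitaryKl Vu) mulmx1.
  have -> : rtr (T *m (fcal U (fun j => ln (t j) + 1) - fcal V (fun j => ln (m j)))) =
      rtr ((U *m T *m U^H) *m
        gram C (fun i j k => Tcoef_const (t i) (t j) - ln (m k))).
    rewrite -(rtr_unitary_conj _ Uu) gram_Tcoef_const// !mulmxBr mulmxBl !rtrB.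
    congr (_ - _).
      transitivity (rtr (U *m T *m U^H *m dg (fun j => ln (t j) + 1) *m (U *m U^H))).
        by rewrite /fcal !mulmxA.
      by rewrite (unitaryKl Uu) mulmx1.
    transitivity (rtr (U *m T *m (U^H *m U) *m fcal V (fun j => ln (m j)) *m U^H)).
      by rewrite (unitaryKr Uu) mulmx1 !mulmxA.
    by rewrite /C /fcal adjM adjK !mulmxA.
  rewrite mulmxBr rtrB (fcalM _ _ Uu') rtr_fcal// rtr_fcal2 -/C'.
  rewrite !rtr_gram /Phi.
  have -> : \sum_j t' j * ln (t' j) = \sum_a \sum_b t' a * ln (t' a) * csq (C' a b).
    by apply: eq_bigr => a _; rewrite -mulr_sumr unitary_row_csq// mulr1.
  have e1 : \sum_a \sum_b csq (C' a b) * (- t' a * ln (lin (t' a) (a' b) 1))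
     - \sum_a \sum_b csq (C' a b) * (- t' a * ln (lin (t' a) (a' b) 0)) =
     \sum_a \sum_b t' a * ln (t' a) * csq (C' a b) -
     \sum_a \sum_b t' a * ln (a' b) * csq (C' a b).
    rewrite -!sumrB; apply: eq_bigr => a _; rewrite -!sumrB.
    apply: eq_bigr => b _; rewrite /lin subr0 subrr !mul0r !mul1r add0r addr0.
    by ring.
  have e2 : (\sum_i \sum_j \sum_k al i j k * Tcoef (t i) (t j) (m k) 1)
     - \sum_i \sum_j \sum_k al i j k * Tcoef (t i) (t j) (m k) 0 =
     \sum_i \sum_j \sum_k al i j k * (Tcoef_const (t i) (t j) - ln (m k)).
    rewrite -!sumrB; apply: eq_bigr => i _; rewrite -!sumrB.
    apply: eq_bigr => j _; rewrite -!sumrB; apply: eq_bigr => k _.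
    by rewrite -mulrBr Tcoef_increment.
  have e3 : (\sum_k \sum_l \sum_i be k l i * Acoef (t i) (m k) (m l) 1)
     - \sum_k \sum_l \sum_i be k l i * Acoef (t i) (m k) (m l) 0 =
     \sum_k \sum_l \sum_i be k l i *
       (Acoef (t i) (m k) (m l) 1 - Acoef (t i) (m k) (m l) 0).
    rewrite -!sumrB; apply: eq_bigr => i _; rewrite -!sumrB.
    apply: eq_bigr => j _; rewrite -!sumrB; apply: eq_bigr => k _.
    by rewrite -mulrBr.
  have aux (a1 a0 b1 b0 c1 c0 x y z u : R) : a1 - a0 = x - y -> b1 - b0 = z ->
      c1 - c0 = u -> a1 - b1 + c1 - (a0 - b0 + c0) = x - y - z + u by lra.
  exact: aux e1 e2 e3.
have aux (x y z : R) : 0 <= x - y + z -> y - z <= x by lra.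
exact: aux.
Qed.

End relative_entropy.

(** * From the tangent plane to one random summand *)

Section exponential_step.
Context {R : realType}.

Lemma expR_tangent (y z : R) : expR z * (1 + (y - z)) <= expR y.
Proof.
rewrite -[y in leRHS](subrK z) expRD [leRHS]mulrC ler_pM2l ?expR_gt0//.
exact: expR_ge1Dx.
Qed.

(** Tangent inequalities at x, evaluated at the two endpoints and weighted by the opposite
    distances: the first-order terms cancel. The form without division also covers lo = hi. *)
Lemma expR_chord (k lo hi x : R) : lo <= x <= hi ->
  (hi - lo) * expR (k * x) <= (x - lo) * expR (k * hi) + (hi - x) * expR (k * lo).
Proof.
move=> /andP[lx xh].
have h1 := expR_tangent (k * hi) (k * x).
have h2 := expR_tangent (k * lo) (k * x).
have := lerD (ler_wpM2l (_ : 0 <= x - lo) h1) (ler_wpM2l (_ : 0 <= hi - x) h2).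
rewrite !subr_ge0 => /(_ lx xh); apply: le_trans.
by rewrite le_eqVlt; apply/orP; left; apply/eqP; ring.
Qed.

(** Slope over [0, L] of the chord of e^(th x), which starts at height 1; negative for th < 0. *)
Definition chord_slope (th L : R) : R := (expR (th * L) - 1) / L.

Lemma expR_le_chord (th L x : R) : 0 < L -> 0 <= x <= L ->
  expR (th * x) <= 1 + chord_slope th L * x.
Proof.
move=> L0 x01; have := expR_chord th x01.
rewrite subr0 mulr0 expR0 mulr1 => h.
rewrite -(ler_pM2l L0); apply: (le_trans h); rewrite /chord_slope.
by rewrite le_eqVlt; apply/orP; left; apply/eqP; field; rewrite gt_eqF.
Qed.

Section square.
Context {d : nat}.
Implicit Types (A B U V H X : 'M[R[i]]_d) (f g : 'I_d -> R).

Lemma rtr_fcal2_ge0 U V f g : (forall i, 0 <= f i) -> (forall i, 0 <= g i) ->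
  0 <= rtr (fcal U f *m fcal V g).
Proof.
move=> f0 g0; rewrite rtr_fcal2; apply: sumr_ge0 => a _; apply: sumr_ge0 => b _.
by rewrite !mulr_ge0 ?csq_ge0.
Qed.

Lemma hermD A B : A \is hermsymmx -> B \is hermsymmx -> A + B \is hermsymmx.
Proof.
move=> /hermP hA /hermP hB; apply/hermP; rewrite adjE raddfD map_mxD -!adjE.
by rewrite hA hB.
Qed.

Lemma hermZ (c : R) A : A \is hermsymmx -> c%:C *: A \is hermsymmx.
Proof.
by move=> /spectral_decomposition[U [f [_ ->]]]; rewrite fcalZ fcal_herm.
Qed.

Lemma fcal_affine U (c : R) f : U \is unitarymx ->
  1%:M + c%:C *: fcal U f = fcal U (fun j => 1 + c * f j).
Proof. by move=> Uu; rewrite fcalZ (fcalc 1 Uu) fcalD. Qed.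

(* With T' = exp(H + th X), T = exp(H + g A), M = 1 + g A and A' = 1 + g X the
   relative entropy inequality becomes tr T' <= tr (A' K), because
   th X <= ln(1 + g X) and ln(1 + g A) <= g A. *)
Lemma trexp_tangent H V (mu : 'I_d -> R) (th L : R) (g := chord_slope th L)
    (A := fcal V mu) :
  0 < L -> H \is hermsymmx -> V \is unitarymx -> (forall j, 0 <= mu j <= L) ->
  exists2 K : 'M[R[i]]_d, rtr (K *m (1%:M + g%:C *: A)) = trexp (H + g%:C *: A) &
  forall V' (x : 'I_d -> R), V' \is unitarymx -> (forall j, 0 <= x j <= L) ->
    trexp (H + th%:C *: fcal V' x) <=
    rtr (K *m (1%:M + g%:C *: fcal V' x)).
Proof.
have aux (a b c e k : R) : 0 <= a -> 0 <= b ->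
  c + e + b - k <= c - a -> e <= k by lra.
move=> L0 Hh Vu mu01.
(* The logarithms need 1 + g x > 0 even when g < 0; the chord lies above an exponential. *)
have pos (x : 'I_d -> R) : (forall j, 0 <= x j <= L) -> forall j, 0 < 1 + g * x j.
  by move=> x01 j; apply: lt_le_trans (expR_le_chord th L0 (x01 j)); exact: expR_gt0.
have [U [b [Uu Bb]]] : exists U b, U \is unitarymx /\ H + g%:C *: A = fcal U b.
  exact: (spectral_decomposition (hermD Hh (hermZ _ (fcal_herm _ _)))).
have [K K1 K2] := @relative_entropy_tangent _ _ U V (fun j => expR (b j))
  (fun j => 1 + g * mu j) Uu Vu (fun j => expR_gt0 _) (pos _ mu01).
exists K; first by rewrite fcal_affine// K1 Bb trexp_fcal.
move=> V' x Vu' x01.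
have [U' [b' [Uu' Bb']]] :
    exists U' b', U' \is unitarymx /\ H + th%:C *: fcal V' x = fcal U' b'.
  exact: (spectral_decomposition (hermD Hh (hermZ _ (fcal_herm _ _)))).
have := K2 U' V' (fun j => expR (b' j)) (fun j => 1 + g * x j) Uu' Vu'
  (fun j => expR_gt0 _) (pos _ x01).
set T := fcal U' (fun j => expR (b' j)).
have -> : (fun j => ln (expR (b' j))) = b' by apply/funext => j; rewrite expRK.
have -> : (fun j => ln (expR (b j)) + 1) = (fun j => b j + 1).
  by apply/funext => j; rewrite expRK.
have T0 : forall i, 0 <= expR (b' i) by move=> i; rewrite expR_ge0.
have -> : rtr (T *m (fcal U' b' - fcal V' (fun j => ln (1 + g * x j)))) =
    rtr (T *m H) - rtr (T *m fcal V' (fun j => ln (1 + g * x j) - th * x j)).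
  have -> : fcal U' b' - fcal V' (fun j => ln (1 + g * x j)) =
      H - fcal V' (fun j => ln (1 + g * x j) - th * x j).
    by rewrite -Bb' fcalZ fcalB opprB addrA.
  by rewrite mulmxBr rtrB.
have -> : rtr (T *m (fcal U (fun j => b j + 1) - fcal V (fun j => ln (1 + g * mu j)))) =
    rtr (T *m H) + rtr T + rtr (T *m fcal V (fun j => g * mu j - ln (1 + g * mu j))).
  have -> : fcal U (fun j => b j + 1) - fcal V (fun j => ln (1 + g * mu j)) =
      H + 1%:M + fcal V (fun j => g * mu j - ln (1 + g * mu j)).
    rewrite -fcalD -(fcalc 1 Uu) -Bb fcalZ fcalB [RHS]addrA.
    by congr (_ - _); exact: addrAC.
  by rewrite !mulmxDr mulmx1 !rtrD.
rewrite fcal_affine// Bb' trexp_fcal// -(rtr_fcal _ Uu') -/T (rtrC K).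
have h1 : 0 <= rtr (T *m fcal V' (fun j => ln (1 + g * x j) - th * x j)).
  apply: rtr_fcal2_ge0 => // j; rewrite subr_ge0 -[leLHS]expRK.
  by rewrite ler_ln ?posrE ?expR_gt0 ?pos// expR_le_chord.
have h2 : 0 <= rtr (T *m fcal V (fun j => g * mu j - ln (1 + g * mu j))).
  apply: rtr_fcal2_ge0 => // j; rewrite subr_ge0 le_ln1Dx//.
  by rewrite -subr_gt0 opprK addrC pos.
exact: aux.
Qed.

Lemma scalar_of_const_spectrum U (c : R) f : U \is unitarymx ->
  (forall j, f j = c) -> fcal U f = (c%:C)%:M.
Proof.
by move=> Uu fc; rewrite (fcalc c Uu); congr fcal; apply/funext.
Qed.

Lemma upper_dim_fcal U f (hi lo : R) : U \is unitarymx ->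
  opnorm (fcal U f) = hi -> lambda_min (fcal U f) = lo ->
  upper_dim (fcal U f) = (\sum_j (f j - lo)) / (hi - lo).
Proof.
move=> Uu hE lE; rewrite /upper_dim hE lE (fcalc lo Uu) -fcalB.
by rewrite -/(rtr _) rtr_fcal.
Qed.

Lemma lower_dim_fcal U f (hi lo : R) : U \is unitarymx ->
  opnorm (fcal U f) = hi -> lambda_min (fcal U f) = lo ->
  lower_dim (fcal U f) = (\sum_j (hi - f j)) / (hi - lo).
Proof.
move=> Uu hE lE; rewrite /lower_dim hE lE (fcalc hi Uu) -fcalB.
by rewrite -/(rtr _) rtr_fcal.
Qed.

(** Each eigenvalue is a convex combination of hi and lo. Summed over the spectrum, the weights of
    hi give the upper and those of lo the lower intrinsic dimension. The sign of k is free, as both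
    tails require. *)
Lemma trexp_intrinsic_dim U f (k hi lo : R) : U \is unitarymx ->
  opnorm (fcal U f) = hi -> lambda_min (fcal U f) = lo -> lo < hi ->
  (forall j, lo <= f j <= hi) ->
  trexp (k%:C *: fcal U f) <=
  upper_dim (fcal U f) * expR (k * hi) + lower_dim (fcal U f) * expR (k * lo).
Proof.
move=> Uu hE lE lohi fb.
rewrite (upper_dim_fcal Uu hE lE) (lower_dim_fcal Uu hE lE) fcalZ trexp_fcal//.
rewrite -(mulrAC _ _ (_^-1)) -[X in _ + X]mulrAC -mulrDl ler_pdivlMr ?subr_gt0//.
rewrite !mulr_suml -big_split; apply: ler_sum => j _.
by rewrite mulrC; exact: expR_chord.
Qed.

End square.
End exponential_step.

(** * Random matrices *)

Section measurable_matrices.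
Context {R : realType} {d : nat}.

Lemma ReM (z w : R[i]) :
  complex.Re (z * w) = complex.Re z * complex.Re w - complex.Im z * complex.Im w.
Proof. by case: z w => [a b] [c e]. Qed.

Lemma ImM (z w : R[i]) :
  complex.Im (z * w) = complex.Re z * complex.Im w + complex.Im z * complex.Re w.
Proof. by case: z w => [a b] [c e]. Qed.

Section source.
Context {disp : measure_display} {T : measurableType disp}.
Implicit Types Y Z : T -> 'M[R[i]]_d.

(** Entrywise and real, so that the measurability rules for real functions apply; equivalent to
    measurability into [borel_mx]. *)
Definition mxmeas Y := forall i j,
  measurable_fun setT (fun t => complex.Re (Y t i j)) /\
  measurable_fun setT (fun t => complex.Im (Y t i j)).

Lemma mxmeas_cst A : mxmeas (fun=> A).
Proof. by []. Qed.

Lemma mxmeasD Y Z : mxmeas Y -> mxmeas Z -> mxmeas (fun t => Y t + Z t).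
Proof.
move=> mY mZ i j; have [? ?] := mY i j; have [? ?] := mZ i j; split.
  by under eq_fun do rewrite mxE ReD; exact: measurable_funD.
by under eq_fun do rewrite mxE ImD; exact: measurable_funD.
Qed.

Lemma mxmeasM Y Z : mxmeas Y -> mxmeas Z -> mxmeas (fun t => Y t *m Z t).
Proof.
move=> mY mZ i j; split.
  under eq_fun do rewrite mxE Re_sum.
  apply: measurable_sum => k; have [? ?] := mY i k; have [? ?] := mZ k j.
  under eq_fun do rewrite ReM.
  by apply: measurable_funB; exact: measurable_funM.
under eq_fun do rewrite mxE Im_sum.
apply: measurable_sum => k; have [? ?] := mY i k; have [? ?] := mZ k j.
under eq_fun do rewrite ImM.
by apply: measurable_funD; exact: measurable_funM.
Qed.

Lemma mxmeasZ (c : R) Y : mxmeas Y -> mxmeas (fun t => c%:C *: Y t).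
Proof.
move=> mY i j; have [? ?] := mY i j; split.
  by under eq_fun do rewrite mxE ReZl; exact: measurable_funM.
by under eq_fun do rewrite mxE ImZl; exact: measurable_funM.
Qed.

Lemma mxmeas_adj Y : mxmeas Y -> mxmeas (fun t => (Y t)^H).
Proof.
move=> mY i j; have [? ?] := mY j i; split.
  by under eq_fun do rewrite adj_mxE Re_conjc.
by under eq_fun do rewrite adj_mxE Im_conjc; exact: measurableT_comp.
Qed.

Lemma mxmeas_sum (I : Type) (r : seq I) (Q : pred I) (Y : I -> T -> 'M[R[i]]_d) :
  (forall i, mxmeas (Y i)) -> mxmeas (fun t => \sum_(i <- r | Q i) Y i t).
Proof.
move=> mY; elim: r => [|i r IH].
  by under eq_fun do rewrite big_nil; exact: mxmeas_cst.
under eq_fun do rewrite big_cons; case: (Q i) => //.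
exact: mxmeasD.
Qed.

Lemma mxmeasX Y k : mxmeas Y -> mxmeas (fun t => Y t ^+ k).
Proof.
move=> mY; elim: k => [|k IH]; first exact: mxmeas_cst.
by under eq_fun do rewrite exprS; exact: mxmeasM.
Qed.

Lemma measurable_rtr Y : mxmeas Y -> measurable_fun setT (fun t => rtr (Y t)).
Proof.
move=> mY; rewrite /rtr; under eq_fun do rewrite Re_sum.
by apply: measurable_sum => i; have [] := mY i i.
Qed.

(** A pointwise limit of traces of polynomials in the matrix; being Hermitian provides the
    convergence. *)
Lemma measurable_trexp Y : mxmeas Y -> (forall t, Y t \is hermsymmx) ->
  measurable_fun setT (fun t => trexp (Y t)).
Proof.
move=> mY hY.
apply: (@measurable_fun_cvg _ _ _ _
  (fun N t => series (fun k => rtr (Y t ^+ k) / k`!%:R) N)).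
  move=> N; rewrite /series /=; apply: measurable_sum => k.
  by apply: measurable_funM => //; exact/measurable_rtr/mxmeasX.
by move=> t _; rewrite trexpE; apply: is_cvg_trexp.
Qed.

Lemma mxmeas_measurable Y : mxmeas Y ->
  measurable_fun setT (Y : T -> borel_mx R d).
Proof.
move=> mY; apply: (@measurability _ _ T (borel_mx R d) setT Y (@mx_cylinders R d)) => //.
move=> _ [_ [i [j [B [mB [->|->]]]]] <-]; have [mR mI] := mY i j.
  by rewrite -[X in measurable X]/(setT `&` (fun t => complex.Re (Y t i j)) @^-1` B);
    exact: mR.
by rewrite -[X in measurable X]/(setT `&` (fun t => complex.Im (Y t i j)) @^-1` B);
  exact: mI.
Qed.

End source.

Lemma mxmeas_id : mxmeas (fun M : borel_mx R d => (M : 'M[R[i]]_d)).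
Proof.
move=> i j; split=> _ B mB; rewrite setTI; apply: sub_sigma_algebra;
  exists i, j, B; split => //.
  by left.
by right.
Qed.

Lemma measurable_mxmeas {disp : measure_display} {T : measurableType disp}
    (Y : T -> borel_mx R d) : measurable_fun setT Y ->
  mxmeas (fun t => (Y t : 'M[R[i]]_d)).
Proof.
by move=> mY i j; have [mR mI] := mxmeas_id i j; split;
  [exact: (measurableT_comp mR mY)|exact: (measurableT_comp mI mY)].
Qed.

(* Agrees with A when A is Hermitian, and keeps trexp meaningful on all of borel_mx. *)
Definition hermpart (A : 'M[R[i]]_d) := (2^-1)%:C *: (A + A^H).

Lemma hermpart_herm A : hermpart A \is hermsymmx.
Proof.
by apply/hermZ/hermP; rewrite adjE raddfD map_mxD -!adjE adjK addrC.
Qed.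

Lemma hermpart_id A : A \is hermsymmx -> hermpart A = A.
Proof.
move=> /hermP Ah; rewrite /hermpart Ah -mulr2n.
rewrite -(scaler_nat 2 A) scalerA -(rmorph_nat (real_complex R)) -rmorphM.
by rewrite mulVf ?pnatr_eq0// rmorph1 scale1r.
Qed.

Lemma mxmeas_hermpart {disp : measure_display} {T : measurableType disp}
  (Y : T -> 'M[R[i]]_d) : mxmeas Y -> mxmeas (fun t => hermpart (Y t)).
Proof. by move=> mY; exact/mxmeasZ/mxmeasD/mxmeas_adj. Qed.

End measurable_matrices.

(** * Real and matrix expectations *)

Section expectations.
Context {disp : measure_display} {T : measurableType disp} {R : realType}.
Variable P : probability T R.

(** Integrability is bundled with a finite value, so that linearity composes without finiteness side
    conditions. *)
Definition hasE (f : T -> R) (c : R) :=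
  P.-integrable setT (EFin \o f) /\ (\int[P]_t (f t)%:E = c%:E)%E.

Lemma integral_prob_cst (c : R) : (\int[P]_t c%:E = c%:E)%E.
Proof.
have -> := integral_cst P measurableT c%:E.
apply: (etrans (congr1 (fun x => c%:E * x)%E (probability_setT P))).
by rewrite mule1.
Qed.

Lemma hasE_cst c : hasE (fun=> c) c.
Proof.
split; first exact: finite_measure_integrable_cst.
exact: integral_prob_cst.
Qed.

Lemma hasED f g a b : hasE f a -> hasE g b -> hasE (fun t => f t + g t) (a + b).
Proof.
move=> [fi fE] [gi gE]; split; first exact: (integrableD measurableT fi gi).
by under eq_integral do rewrite EFinD; rewrite integralD_EFin// fE gE EFinD.
Qed.

Lemma hasEZ f (k a : R) : hasE f a -> hasE (fun t => k * f t) (k * a).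
Proof.
move=> [fi fE]; split.
  exact: (integrableZl measurableT k fi).
by under eq_integral do rewrite EFinM; rewrite integralZl// fE EFinM.
Qed.

Lemma hasE_sum (I : Type) (r : seq I) (f : I -> T -> R) (a : I -> R) :
  (forall i, hasE (f i) (a i)) ->
  hasE (fun t => \sum_(i <- r) f i t) (\sum_(i <- r) a i).
Proof.
move=> h; elim: r => [|i r IH].
  by under eq_fun do rewrite big_nil; rewrite big_nil; exact: hasE_cst.
by under eq_fun do rewrite big_cons; rewrite big_cons; exact: hasED.
Qed.

Lemma hasE_uniq f a b : hasE f a -> hasE f b -> a = b.
Proof. by move=> [_ fa] [_]; rewrite fa => -[]. Qed.

Lemma hasE_ae_ge0 f a : {ae P, forall t, 0 <= f t} -> hasE f a -> 0 <= a.
Proof.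
move=> f0 [/integrableP[mf _] fE]; rewrite -lee_fin -fE.
(* The truncation is nonnegative everywhere and agrees with f almost everywhere. *)
have -> : (\int[P]_t (f t)%:E = \int[P]_t (Num.max (f t) 0)%:E)%E.
  apply: ae_eq_integral => //.
    apply/measurable_EFinP/measurable_maxr => //; exact/measurable_EFinP.
  by apply: filterS f0 => t ft _; rewrite max_l.
by apply: integral_ge0 => t _; rewrite lee_fin le_max lexx orbT.
Qed.

Lemma hasE_bounded (f : T -> R) (c : R) : measurable_fun setT f ->
  {ae P, forall t, `|f t| <= c} -> hasE f (fine (\int[P]_t (f t)%:E)%E).
Proof.
move=> mf fc.
have fi : P.-integrable setT (EFin \o f).
  apply/integrableP; split; first exact/measurable_EFinP.
  apply: (@le_lt_trans _ _ (\int[P]_t (`|c|%:E))%E); last first.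
    by rewrite integral_prob_cst ltry.
  apply: ae_ge0_le_integral => //.
  - exact/measurableT_comp/measurable_EFinP.
  - apply: filterS fc => t h _; rewrite lee_fin.
    by apply: (le_trans h); exact: ler_norm.
split => //; rewrite fineK//; exact: integrable_fin_num.
Qed.

Section matrices.
Context {d : nat}.

Definition mx_hasE (Y : T -> 'M[R[i]]_d) (A : 'M[R[i]]_d) := forall i j,
  hasE (fun t => complex.Re (Y t i j)) (complex.Re (A i j)) /\
  hasE (fun t => complex.Im (Y t i j)) (complex.Im (A i j)).

Lemma mx_hasE_expectation Y A : mx_hasE Y A -> mx_expectation P Y = A.
Proof.
move=> h; apply/matrixP => i j; rewrite mxE !unlock.
have [[_ ->] [_ ->]] := h i j.
by case: (A i j).
Qed.

Lemma mx_hasE_sum (I : Type) (r : seq I) (Y : I -> T -> 'M[R[i]]_d)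
    (A : I -> 'M[R[i]]_d) : (forall i, mx_hasE (Y i) (A i)) ->
  mx_hasE (fun t => \sum_(i <- r) Y i t) (\sum_(i <- r) A i).
Proof.
move=> h i j; rewrite summxE Re_sum Im_sum; split.
  under eq_fun do rewrite summxE Re_sum.
  by apply: hasE_sum => k; have [] := h k i j.
under eq_fun do rewrite summxE Im_sum.
by apply: hasE_sum => k; have [] := h k i j.
Qed.

(** Applied to the tangent functional, this is the only exchange of expectation with a matrix
    operation in the step for one summand. *)
Lemma hasE_rtr K Y A : mx_hasE Y A ->
  hasE (fun t => rtr (K *m Y t)) (rtr (K *m A)).
Proof.
move=> h; rewrite rtrM; under eq_fun do rewrite rtrM.
apply: hasE_sum => i; apply: hasE_sum => j; rewrite ReM.
under eq_fun do rewrite ReM.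
have [hR hI] := h i j; rewrite -mulNr; under eq_fun do rewrite -mulNr.
by apply: hasED; exact: hasEZ.
Qed.

Lemma mx_hasE_herm Y A : (forall t, Y t \is hermsymmx) -> mx_hasE Y A ->
  A \is hermsymmx.
Proof.
move=> hY h; apply/hermP/matrixP => i j; rewrite adj_mxE.
have [hR hI] := h i j; have [hR' hI'] := h j i.
have YE t : Y t i j = ((Y t j i)^*)%R.
  by have /hermP/matrixP/(_ i j) := hY t; rewrite adj_mxE.
apply/eqP; rewrite eq_complex; apply/andP; split; apply/eqP.
  rewrite Re_conjc; apply: hasE_uniq hR' _.
  by under eq_fun do rewrite -[complex.Re (Y _ j i)]Re_conjc -YE.
rewrite Im_conjc; apply: hasE_uniq hI.
under eq_fun do rewrite YE Im_conjc -mulN1r.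
by rewrite -[- complex.Im (A j i)]mulN1r; exact: hasEZ.
Qed.

End matrices.
End expectations.

(** * Joint laws of independent variables *)

Section joint_laws.
Local Open Scope ereal_scope.
Context {disp : measure_display} {T : measurableType disp} {R : realType}.
Variable P : probability T R.

Definition rv_of {d1 : measure_display} {T1 : measurableType d1} (f : T -> T1)
    (mf : measurable_fun setT f) : {RV P >-> T1} :=
  HB.pack f (isMeasurableFun.Build _ _ _ _ _ mf).

Section pair.
Context {d1 d2 : measure_display}.
Context {T1 : measurableType d1} {T2 : measurableType d2}.
Variables (f : {RV P >-> T1}) (g : {RV P >-> T2}).

Let pair_meas : measurable_fun setT (fun t => (f t, g t)).
Proof. by apply: measurable_fun_pair; exact: measurable_funPT. Qed.

(* The extra event E lets independence from further variables survive summation. *)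
Lemma joint_law (E : set T) : measurable E ->
  (forall A B, measurable A -> measurable B ->
    P (f @^-1` A `&` g @^-1` B `&` E) = P (f @^-1` A) * P (g @^-1` B) * P E) ->
  forall Z : set (T1 * T2), measurable Z ->
    P ((fun t => (f t, g t)) @^-1` Z `&` E) =
    P E * (distribution P f \x distribution P g) Z.
Proof.
move=> mE fgE Z mZ.
have PEfin : P E \is a fin_num by exact: fin_num_measure.
have PE0 : (0 <= fine (P E))%R by rewrite fine_ge0.
pose c := NngNum PE0.
pose m2 := mscale c (distribution P g).
pose m3 : {measure set (T1 * T2) -> \bar R} :=
  mscale c (distribution P f \x distribution P g).
pose m' : {measure set (T1 * T2) -> \bar R} :=
  measure_function_pushforward__canonical__measure_function_Measure
    (mrestr P mE) pair_meas.
(* Uniqueness of product measures compares a measure with a genuine product, so the law of f times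
   the scaled law of g is the link between [m'] and [m3]. *)
have e1 : (distribution P f \x m2) Z = m' Z.
  apply: product_measure_unique => // A B mA mB.
  rewrite -[LHS]/(P (f @^-1` A `&` g @^-1` B `&` E)) fgE//.
  rewrite -[RHS]/(P (f @^-1` A) * ((fine (P E))%:E * P (g @^-1` B))) fineK//.
  by rewrite -muleA (muleC (P E)).
have e2 : (distribution P f \x m2) Z = m3 Z.
  apply: product_measure_unique => // A B mA mB.
  rewrite -[LHS]/((fine (P E))%:E *
    (distribution P f \x distribution P g) (A `*` B)) product_measure1E//.
  by rewrite -[RHS]/(distribution P f A * ((fine (P E))%:E * distribution P g B))
     muleCA.
rewrite -[LHS]/(m' Z) -e1 e2.
rewrite -[LHS]/((fine (P E))%:E * (distribution P f \x distribution P g) Z).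
by rewrite fineK.
Qed.

Lemma integral_joint_law (F : T1 * T2 -> \bar R) :
  (forall A B, measurable A -> measurable B ->
    P (f @^-1` A `&` g @^-1` B) = P (f @^-1` A) * P (g @^-1` B)) ->
  measurable_fun setT F -> (forall z, 0 <= F z) ->
  \int[P]_t F (f t, g t) =
  \int[distribution P f]_x \int[distribution P g]_y F (x, y).
Proof.
move=> fg mF F0.
rewrite -[RHS](@fubini_tonelli1 _ _ _ _ _ (distribution P f) (distribution P g) F mF F0).
have -> : \int[P]_t F (f t, g t) =
    \int[pushforward P (fun t => (f t, g t))]_z F z.
  by rewrite ge0_integral_pushforward.
apply: eq_measure_integral => Z mZ _.
have := @joint_law setT measurableT _ Z mZ.
rewrite setIT (_ : P setT = 1); last exact: probability_setT.
move=> h; rewrite -[LHS]/(P ((fun t => (f t, g t)) @^-1` Z)) h ?mul1e//.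
by move=> A B mA mB; rewrite setIT mule1 fg.
Qed.

(** Takes the place of conditional expectation: bound the integral over g with the value of f
    frozen, then integrate over the law of f. *)
Lemma integral_joint_le (F : T1 * T2 -> \bar R) (G : T1 -> \bar R) :
  (forall A B, measurable A -> measurable B ->
    P (f @^-1` A `&` g @^-1` B) = P (f @^-1` A) * P (g @^-1` B)) ->
  measurable_fun setT F -> (forall z, 0 <= F z) ->
  measurable_fun setT G -> (forall x, 0 <= G x) ->
  (forall x, \int[P]_t F (x, g t) <= G x) ->
  \int[P]_t F (f t, g t) <= \int[P]_t G (f t).
Proof.
move=> fg mF F0 mG G0 FG; rewrite integral_joint_law//.
rewrite -[leRHS](ge0_integral_distribution f mG G0).
apply: ge0_le_integral => //.
- by move=> x _; exact: integral_ge0.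
- exact: (@measurable_fun_fubini_tonelli_F _ _ _ _ _ (distribution P g) F mF F0).
- move=> x _.
  have mFx : measurable_fun setT (fun y => F (x, y)).
    exact: measurable_fun_pair2.
  by rewrite (ge0_integral_distribution g mFx (fun y => F0 (x, y))) /= FG.
Qed.

End pair.
End joint_laws.

(** * Peeling off independent summands *)

Section sums_of_independent_matrices.
Context {disp : measure_display} {T : measurableType disp} {R : realType}.
Variable P : probability T R.
Context {n d : nat} (X : 'I_n -> {RV P >-> borel_mx R d}).
Hypothesis indepX : mutually_independent X.

Definition seq_sum (s : seq 'I_n) (t : T) : borel_mx R d :=
  \sum_(i <- s) (X i t : 'M[R[i]]_d).

Lemma mxmeas_X i : mxmeas (fun t => (X i t : 'M[R[i]]_d)).
Proof. exact/measurable_mxmeas/measurable_funPT. Qed.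

Lemma measurable_seq_sum s : measurable_fun setT (seq_sum s).
Proof. by apply: mxmeas_measurable; apply: mxmeas_sum => i; exact: mxmeas_X. Qed.

Lemma measurable_addmx : measurable_fun setT
  (fun z : borel_mx R d * borel_mx R d => (z.1 + z.2 : 'M[R[i]]_d) : borel_mx R d).
Proof.
apply: mxmeas_measurable; apply: mxmeasD; apply: measurable_mxmeas.
  exact: measurable_fst.
exact: measurable_snd.
Qed.

(** Independence of the sum from a whole further family is what the induction needs: splitting off
    [X j] moves j into the family [J] of the induction hypothesis. *)
Lemma seq_sum_indep (s : seq 'I_n) (J : {set 'I_n}) (B : set (borel_mx R d))
    (Bs : 'I_n -> set (borel_mx R d)) :
  uniq s -> (forall i, i \in s -> i \notin J) ->
  measurable B -> (forall i, measurable (Bs i)) ->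
  P (seq_sum s @^-1` B `&` \bigcap_(i in [set` J]) (X i @^-1` Bs i)) =
  (P (seq_sum s @^-1` B) * \prod_(i in J) P (X i @^-1` Bs i))%E.
Proof.
elim: s J B Bs => [|j s IH] J B Bs.
  move=> _ _ mB mBs.
  (* The empty sum is the constant 0, so its preimage of [B] is everything or nothing. *)
  have [B0|B0] := pselect (B (0 : 'M[R[i]]_d)).
    have -> : seq_sum [::] @^-1` B = setT.
      by apply/seteqP; split => // t _; rewrite /= /seq_sum big_nil.
    rewrite setTI indepX// (_ : P setT = 1%E) ?mul1e//.
    exact: probability_setT.
  have -> : seq_sum [::] @^-1` B = set0.
    by apply/seteqP; split => // t; rewrite /= /seq_sum big_nil.
  by rewrite set0I measure0 mul0e.
move=> /= /andP[js us] sJ mB mBs.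
set E := \bigcap_(i in _) _.
pose g := rv_of P (measurable_seq_sum s).
have mX i A : measurable A -> measurable (X i @^-1` A).
  by move=> mA; rewrite -[X in measurable X]setTI; exact: measurable_funPT.
have mE : measurable E.
  by apply: fin_bigcap_measurable => // i _; exact: mX.
have PE : P E = (\prod_(i in J) P (X i @^-1` Bs i))%E by exact: indepX.
pose Z : set (borel_mx R d * borel_mx R d) :=
  [set z | B ((z.1 + z.2 : 'M[R[i]]_d))].
have mZ : measurable Z.
  by rewrite -[X in measurable X]setTI; exact: measurable_addmx.
have sumE : seq_sum (j :: s) @^-1` B = (fun t => (X j t, g t)) @^-1` Z.
  by apply/seteqP; split => t; rewrite /= /seq_sum big_cons.
have jJ : j \notin J by apply: sJ; rewrite mem_head.
have rect A C : measurable A -> measurable C ->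
    P (X j @^-1` A `&` g @^-1` C) = (P (X j @^-1` A) * P (g @^-1` C))%E.
  move=> mA mC; rewrite setIC.
  have := IH [set j]%SET C (fun=> A) us _ mC (fun=> mA).
  rewrite big_set1 muleC => <-; last first.
    by move=> i si; rewrite inE; apply: contra js => /eqP <-.
  congr (P (_ `&` _)); apply/seteqP; split => t /=.
    by move=> tA i; rewrite /= inE => /eqP ->.
  by apply; rewrite /= inE.
have rectE A C : measurable A -> measurable C ->
    P (X j @^-1` A `&` g @^-1` C `&` E) =
    (P (X j @^-1` A) * P (g @^-1` C) * P E)%E.
  move=> mA mC; rewrite PE.
  (* The family enlarged by j, with the event [A] at the new index. *)
  pose Bs' i := if i == j then A else Bs i.
  have mBs' i : measurable (Bs' i) by rewrite /Bs'; case: ifP.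
  have := IH (j |: J)%SET C Bs' us _ mC mBs'.
  rewrite big_setU1//= {2}/Bs' eqxx.
  have -> : (\prod_(i in J) P (X i @^-1` Bs' i) =
             \prod_(i in J) P (X i @^-1` Bs i))%E.
    apply: eq_bigr => i iJ; rewrite /Bs'; case: eqP => // ij.
    by rewrite -ij iJ in jJ.
  rewrite muleA (muleC (P (g @^-1` C))) => <-; last first.
    move=> i si; rewrite !inE negb_or sJ ?inE ?si ?orbT// andbT.
    by apply: contra js => /eqP <-.
  congr (P _); apply/seteqP; split => t /=.
    move=> [[tA tC] tE]; split => // i /=; rewrite !inE /Bs'.
    by case: eqP => [->//|_ /= iJ]; exact: tE.
  move=> [tC tE]; split; first split => //.
    by have := tE j; rewrite /Bs' eqxx; apply; rewrite /= !inE eqxx.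
  move=> i /= iJ; have := tE i; rewrite /Bs'; case: eqP => [ij|_].
    by rewrite -ij iJ in jJ.
  by apply; rewrite /= !inE iJ orbT.
(* The joint law is used with [E] and then with the whole space: both sides become P E times the
   same product measure of [Z]. *)
rewrite sumE (joint_law mE rectE mZ) -PE muleC; congr (_ * _)%E.
have := @joint_law _ _ _ P _ _ _ _ (X j) g setT measurableT _ Z mZ.
rewrite setIT (_ : P setT = 1%E); last exact: probability_setT.
by rewrite mul1e => -> // A C mA mC; rewrite setIT mule1 rect.
Qed.

Lemma X_seq_sum_indep j s (A B : set (borel_mx R d)) :
  uniq (j :: s) -> measurable A -> measurable B ->
  P (X j @^-1` A `&` seq_sum s @^-1` B) =
  (P (X j @^-1` A) * P (seq_sum s @^-1` B))%E.
Proof.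
move=> /= /andP[js us] mA mB; rewrite setIC.
have := @seq_sum_indep s [set j]%SET B (fun=> A) us _ mB (fun=> mA).
rewrite big_set1 muleC => <-; last first.
  by move=> i si; rewrite inE; apply: contra js => /eqP <-.
congr (P (_ `&` _)); apply/seteqP; split => t /=.
  by move=> tA i; rewrite /= inE => /eqP ->.
by apply; rewrite /= inE.
Qed.

Lemma expectation_trexp_sum (th : R) (G : 'M[R[i]]_d) :
  (forall i t, (X i t : 'M[R[i]]_d) \is hermsymmx) -> G \is hermsymmx ->
  (forall i H, H \is hermsymmx ->
    (\int[P]_t (trexp (H + th%:C *: (X i t : 'M[R[i]]_d)))%:E <=
     (trexp (H + G))%:E)%E) ->
  forall s H, uniq s -> H \is hermsymmx ->
  (\int[P]_t (trexp (H + th%:C *: (seq_sum s t : 'M[R[i]]_d)))%:E <=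
   (trexp (H + (size s)%:R *: G))%:E)%E.
Proof.
move=> Xh Gh step; elim=> [|j s IH] H us Hh.
  under eq_integral do rewrite /seq_sum big_nil scaler0 addr0.
  by rewrite integral_prob_cst scale0r addr0.
have sh t : (seq_sum s t : 'M[R[i]]_d) \is hermsymmx.
  rewrite /seq_sum; elim: (s) => [|k r IHr]; rewrite ?big_nil ?big_cons.
    by apply/hermP; rewrite adjE trmx0 map_mx0.
  exact: (hermD (Xh k t) IHr).
have Gsh : (size s)%:R *: G \is hermsymmx.
  by rewrite -(rmorph_nat (real_complex R)); exact: hermZ.
pose hp (x : borel_mx R d) : 'M[R[i]]_d := th%:C *: hermpart (x : 'M[R[i]]_d).
have hph x : hp x \is hermsymmx by exact/hermZ/hermpart_herm.
have hpE (x : borel_mx R d) : (x : 'M[R[i]]_d) \is hermsymmx ->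
    hp x = th%:C *: (x : 'M[R[i]]_d).
  by move=> xh; rewrite /hp hermpart_id.
have [Psi [mPsi Psi0 PsiE]] : exists Psi : borel_mx R d * borel_mx R d -> \bar R,
    [/\ measurable_fun setT Psi, forall z, (0 <= Psi z)%E &
     forall x y, (y : 'M[R[i]]_d) \is hermsymmx ->
       Psi (x, y) = (trexp (H + hp x + th%:C *: (y : 'M[R[i]]_d)))%:E].
  have zh z : H + hp z.1 + hp z.2 \is hermsymmx.
    exact: (hermD (hermD Hh (hph _)) (hph _)).
  exists (fun z => (trexp (H + hp z.1 + hp z.2))%:E); split.
  - apply/measurable_EFinP; apply: measurable_trexp => //.
    apply: mxmeasD; first apply: mxmeasD; first exact: mxmeas_cst.
      by apply/mxmeasZ/mxmeas_hermpart/measurable_mxmeas; exact: measurable_fst.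
    by apply/mxmeasZ/mxmeas_hermpart/measurable_mxmeas; exact: measurable_snd.
  - by move=> z; rewrite lee_fin; exact: trexp_ge0 (zh z).
  - by move=> x y yh /=; rewrite (hpE y yh).
pose H' := H + (size s)%:R *: G.
have H'h : H' \is hermsymmx by exact: (hermD Hh Gsh).
have [Phi [mPhi Phi0 PhiE]] : exists Phi : borel_mx R d -> \bar R,
    [/\ measurable_fun setT Phi, forall x, (0 <= Phi x)%E &
     forall x, Phi x = (trexp (H' + hp x))%:E].
  exists (fun x => (trexp (H' + hp x))%:E); split => //.
  - apply/measurable_EFinP; apply: measurable_trexp.
      by apply: mxmeasD; [exact: mxmeas_cst|exact/mxmeasZ/mxmeas_hermpart/mxmeas_id].
    by move=> x; exact: (hermD H'h (hph x)).
  - by move=> x; rewrite lee_fin; exact: trexp_ge0 (hermD H'h (hph x)).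
pose g := rv_of P (measurable_seq_sum s).
(* The induction hypothesis with offset [H + hp x]. *)
have le1 x : (\int[P]_t Psi (x, g t) <= Phi x)%E.
  rewrite PhiE /H' addrAC.
  under eq_integral do rewrite (PsiE _ _ (sh _)).
  exact: (IH _ (andP us).2 (hermD Hh (hph x))).
have h1 := integral_joint_le (f := X j) (g := g)
  (fun A B mA mB => X_seq_sum_indep us mA mB) mPsi Psi0 mPhi Phi0 le1.
have PsiX t : Psi (X j t, g t) =
    (trexp (H + th%:C *: (seq_sum (j :: s) t : 'M[R[i]]_d)))%:E.
  rewrite (PsiE _ _ (sh t)) (hpE _ (Xh j t)).
  by rewrite /seq_sum big_cons scalerDr addrA.
have PhiX t : Phi (X j t) = (trexp (H' + th%:C *: (X j t : 'M[R[i]]_d)))%:E.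
  by rewrite PhiE (hpE _ (Xh j t)).
rewrite (eq_integral _ _ (fun t _ => PsiX t)) in h1.
rewrite (eq_integral _ _ (fun t _ => PhiX t)) in h1.
apply: (le_trans h1); apply: (le_trans (step j H' H'h)).
by rewrite /H' -addrA -{2}[G]scale1r -scalerDl -mulrSr.
Qed.

End sums_of_independent_matrices.

(** * Tail bounds *)

Section spectral_events.
Context {R : realType} {d : nat}.
Implicit Types (A U : 'M[R[i]]_d) (f : 'I_d -> R).

Lemma expR_multiple_unbounded (a : R) (N : nat) : 0 < a ->
  exists k : nat, N%:R < expR (k%:R * a).
Proof.
move=> a0; have [k _ /(_ k (leqnn k)) hk] : \forall k \near \oo, N%:R / a < k%:R.
  exact: nbhs_infty_gtr.
exists k; apply: (@lt_le_trans _ _ (1 + k%:R * a)); last exact: expR_ge1Dx.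
by rewrite ltr_pdivrMr// in hk; rewrite ltr_wpDl.
Qed.

Lemma shift_fcal U f (k c : R) : U \is unitarymx ->
  k%:C *: (fcal U f - (c%:C)%:M) = fcal U (fun j => k * (f j - c)).
Proof. by move=> Uu; rewrite (fcalc c Uu) -fcalB fcalZ. Qed.

(* Two countable descriptions of spectral conditions, which make them measurable. *)
Lemma spectrum_le_trexp U f (c : R) : U \is unitarymx ->
  (forall k : nat, trexp ((k%:R)%:C *: (fcal U f - (c%:C)%:M)) <= d%:R) <->
  (forall j, f j <= c).
Proof.
move=> Uu; split=> [h j|h k].
  (* A single eigenvalue above c contributes e^(k (f j - c)), which eventually exceeds d. *)
  rewrite leNgt; apply/negP => fc; rewrite -subr_gt0 in fc.
  have [k hk] := expR_multiple_unbounded d fc.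
  have := h k; rewrite shift_fcal// trexp_fcal// leNgt => /negP; apply.
  apply: (lt_le_trans hk); rewrite (bigD1 j)//= lerDl.
  by apply: sumr_ge0 => i _; exact: expR_ge0.
rewrite shift_fcal// trexp_fcal//.
apply: (@le_trans _ _ (\sum_(j < d) (1 : R))).
  apply: ler_sum => j _; rewrite -expR0 ler_expR.
  by rewrite mulr_ge0_le0 ?subr_le0.
by rewrite sumr_const card_ord.
Qed.

Lemma spectrum_ge_trexp U f (c : R) : U \is unitarymx ->
  (forall k : nat, 1 <= trexp ((k%:R)%:C *: (fcal U f - (c%:C)%:M))) <->
  (exists j, c <= f j).
Proof.
move=> Uu; split=> [h|[j cf] k]; last first.
  rewrite shift_fcal// trexp_fcal// (bigD1 j)//= -[leLHS]addr0 lerD//.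
    by rewrite -expR0 ler_expR mulr_ge0 ?subr_ge0.
  by apply: sumr_ge0 => i _; exact: expR_ge0.
apply/not_existsP => nf.
have {}nf j : f j < c by rewrite ltNge; apply/negP; exact: nf.
(* In dimension 0 the trace is an empty sum, which contradicts the hypothesis at k = 0. *)
have [d0|d0] := posnP d.
  have := h 0%N; rewrite shift_fcal// trexp_fcal// big1 ?ler10//.
  by move=> j; have := ltn_ord j; rewrite {2}d0.
pose j0 := Ordinal d0.
case: (arg_maxP f (isT : xpredT j0)) => j _ jmax.
have a0 : 0 < c - f j by rewrite subr_gt0.
(* Each of the d terms is at most e^(- k (c - f j)), with f j the largest eigenvalue; for this k
   their sum is below 1. *)
have [k hk] := expR_multiple_unbounded d a0.
have := h k; rewrite shift_fcal// trexp_fcal// leNgt => /negP; apply.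
apply: (@le_lt_trans _ _ (\sum_(i < d) expR (k%:R * (f j - c)))).
  apply: ler_sum => i _; rewrite ler_expR ler_wpM2l// lerD2r.
  exact: jmax.
rewrite sumr_const card_ord -(opprB c (f j)) mulrN expRN.
rewrite -[ltLHS]mulr_natr.
by rewrite [ltLHS]mulrC ltr_pdivrMr ?expR_gt0// mul1r.
Qed.

Lemma fcal_diag U f k : U \is unitarymx ->
  fcal U f k k = (\sum_a f a * csq (U a k))%:C.
Proof.
move=> Uu; rewrite /fcal -mulmxA mxE rmorph_sum; apply: eq_bigr => a _.
by rewrite adj_mxE mul_diag_mx !mxE mulrCA [X in _ * X]mulrC mulCconj -rmorphM.
Qed.

(** An entry is bounded by the norm of its column, and the squared column norm is a diagonal entry
    of A^2, hence an average of the squared eigenvalues. *)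
Lemma fcal_entry_bound U f (L : R) j k : U \is unitarymx ->
  (forall a, 0 <= f a <= L) -> csq (fcal U f j k) <= L ^+ 2.
Proof.
move=> Uu fL.
have e : \sum_i csq (fcal U f i k) = \sum_a f a ^+ 2 * csq (U a k).
  apply: complexI; rewrite -(fcal_diag _ _ Uu) rmorph_sum.
  have -> : fcal U (fun a => f a ^+ 2) = (fcal U f)^H *m fcal U f.
    by rewrite fcal_adj (fcalM _ _ Uu).
  rewrite mxE; apply: eq_bigr => i _.
  by rewrite adj_mxE mulrC mulCconj.
apply: (@le_trans _ _ (\sum_i csq (fcal U f i k))).
  by rewrite (bigD1 j)//= lerDl sumr_ge0// => i _; exact: csq_ge0.
rewrite e -[leRHS]mulr1 -(unitary_col_csq k Uu) mulr_sumr; apply: ler_sum => a _.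
have /andP[f0 fl] := fL a.
by rewrite ler_wpM2r ?csq_ge0// ler_sqr ?nnegrE// (le_trans f0).
Qed.

Lemma Re_Im_bound (z : R[i]) (L : R) : 0 <= L -> csq z <= L ^+ 2 ->
  `|complex.Re z| <= L /\ `|complex.Im z| <= L.
Proof.
move=> L0; case: z => a b; rewrite /csq /= => h; split.
  rewrite -(@ler_sqr _ `|a|) ?nnegrE// real_normK ?num_real//.
  by apply: le_trans h; rewrite lerDl sqr_ge0.
rewrite -(@ler_sqr _ `|b|) ?nnegrE// real_normK ?num_real//.
by apply: le_trans h; rewrite lerDr sqr_ge0.
Qed.

End spectral_events.

Section expectations_more.
Context {disp : measure_display} {T : measurableType disp} {R : realType}.
Variable P : probability T R.

Lemma ae_le_hasE (f g : T -> R) (c : R) : measurable_fun setT f ->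
  (forall t, 0 <= f t) -> {ae P, forall t, f t <= g t} -> hasE P g c ->
  (\int[P]_t (f t)%:E <= c%:E)%E.
Proof.
move=> mf f0 fg [/integrableP[mg _] gE]; rewrite -gE.
have mg' : measurable_fun setT g by exact/measurable_EFinP.
have mmax : measurable_fun setT (fun t => (Num.max (g t) 0)%:E).
  by apply/measurable_EFinP/measurable_maxr.
have -> : (\int[P]_t (g t)%:E = \int[P]_t (Num.max (g t) 0)%:E)%E.
  apply: ae_eq_integral => //.
  by apply: filterS fg => t ft _; rewrite max_l// (le_trans (f0 t)).
apply: ae_ge0_le_integral => //.
- by move=> t _; rewrite lee_fin.
- exact/measurable_EFinP.
- by move=> t _; rewrite lee_fin le_max lexx orbT.
- by apply: filterS fg => t ft _; rewrite lee_fin le_max ft.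
Qed.

Lemma chernoff_markov (f : T -> R) (E : set T) (a c : R) :
  measurable E -> measurable_fun setT f -> (forall t, 0 <= f t) -> 0 < a ->
  (forall t, E t -> a <= f t) -> (\int[P]_t (f t)%:E <= c%:E)%E ->
  (P E <= (c / a)%:E)%E.
Proof.
move=> mE mf f0 a0 Ef fc.
have h : (a%:E * P E <= c%:E)%E.
  apply: le_trans fc; apply: (@le_trans _ _ (\int[P]_(t in E) a%:E)%E).
    by rewrite integral_cst.
  apply: (@le_trans _ _ (\int[P]_(t in E) (f t)%:E)%E).
    apply: ge0_le_integral => //.
    - by move=> t _; rewrite lee_fin ltW.
    - by apply/measurable_EFinP; exact: measurable_funS mf.
  apply: ge0_subset_integral => //; first exact/measurable_EFinP.
  by move=> t _; rewrite lee_fin.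
have PEfin : P E \is a fin_num by exact: fin_num_measure.
rewrite -(fineK PEfin) in h *; rewrite -EFinM !lee_fin in h *.
by rewrite ler_pdivlMr// mulrC.
Qed.

End expectations_more.

(** * Laplace transform of the random sum *)

Section matrix_chernoff.
Context {disp : measure_display} {T : measurableType disp} {R : realType}.
Variable P : probability T R.
Context {n d : nat} (X : 'I_n -> {RV P >-> borel_mx R d}) (L : R) (i0 : 'I_n).
Hypothesis psdX : forall i t, psdmx (X i t : 'M[R[i]]_d).
Hypothesis indepX : mutually_independent X.
Hypothesis idX : identically_distributed X.
Hypothesis L_gt0 : 0 < L.
Hypothesis aeX : {ae P, forall t, loewner_le (X i0 t : 'M[R[i]]_d) (L%:C)%:M}.

Let Xm i t : 'M[R[i]]_d := X i t.

Let Xherm i t : Xm i t \is hermsymmx.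
Proof. by have [] := psdX i t. Qed.

Let Xspec i t : loewner_le (Xm i t) (L%:C)%:M ->
  exists U f, [/\ U \is unitarymx, Xm i t = fcal U f & forall j, 0 <= f j <= L].
Proof.
move=> XL; have [U [f [Uu XE]]] := spectral_decomposition (Xherm i t).
exists U, f; split => // j.
have := psdX i t; rewrite -/(Xm i t) XE => /(psdmx_eigen_ge0 Uu) ->/=.
by move: XL; rewrite XE => /(fcal_loewner_scalar _ _ Uu).
Qed.

Lemma loewner_scalar_trexp (A : 'M[R[i]]_d) : A \is hermsymmx ->
  loewner_le A (L%:C)%:M <->
  forall k : nat, trexp ((k%:R)%:C *: (A - (L%:C)%:M)) <= d%:R.
Proof.
move=> /spectral_decomposition[U [f [Uu ->]]].
by rewrite (fcal_loewner_scalar _ _ Uu) (spectrum_le_trexp _ _ Uu).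
Qed.

Lemma herm_shift (A : 'M[R[i]]_d) (k c : R) : A \is hermsymmx ->
  k%:C *: (A - (c%:C)%:M) \is hermsymmx.
Proof.
by move=> /spectral_decomposition[U [f [Uu ->]]]; rewrite shift_fcal// fcal_herm.
Qed.

Lemma measurable_trexp_shift {disp' : measure_display} {T' : measurableType disp'}
    (Y : T' -> 'M[R[i]]_d) (k c : R) :
  mxmeas Y -> (forall t, Y t \is hermsymmx) ->
  measurable_fun setT (fun t => trexp (k%:C *: (Y t - (c%:C)%:M))).
Proof.
move=> mY hY; apply: measurable_trexp => [|t]; last exact: herm_shift.
by apply: mxmeasZ; apply: mxmeasD => //; exact: mxmeas_cst.
Qed.

(** The bound is assumed for one index only. Equality of laws carries it over once it is a
    measurable condition on the value of the matrix. *)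
Lemma ae_bounded i : {ae P, forall t, loewner_le (Xm i t) (L%:C)%:M}.
Proof.
pose B := \bigcap_(k : nat) [set x : borel_mx R d |
  trexp ((k%:R)%:C *: (hermpart (x : 'M[R[i]]_d) - (L%:C)%:M)) <= d%:R].
have mB : measurable B.
  apply: bigcapT_measurable => k.
  have := @measurable_trexp_shift _ (borel_mx R d) (fun x => hermpart (x : 'M[R[i]]_d))
    k%:R L (mxmeas_hermpart mxmeas_id) (fun x => hermpart_herm _).
  move=> /(_ measurableT [set` `]-oo, d%:R]%R] (measurable_itv _)).
  by rewrite setTI; congr measurable; apply/seteqP; split => x /=; rewrite in_itv.
have BP j t : B (X j t) <-> loewner_le (Xm j t) (L%:C)%:M.
  rewrite loewner_scalar_trexp//; split => h k.
    by have := h k Logic.I; rewrite /= (hermpart_id (Xherm j t)).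
  by move=> _; rewrite /= (hermpart_id (Xherm j t)); exact: h.
have mBC : measurable (~` B) by exact: measurableC.
have mXB j : measurable (X j @^-1` (~` B)).
  by rewrite -[X in measurable X]setTI; exact: measurable_funPT.
have PB0 : P (X i0 @^-1` (~` B)) = 0%E.
  have [N [mN N0 sN]] := aeX.
  apply: (subset_measure0 (mXB i0) mN _ N0).
  by move=> t tB; apply: sN => /= /BP.
exists (X i @^-1` (~` B)); split; first exact: mXB.
  exact: (etrans (idX i i0 mBC) PB0).
by move=> t /= h /BP.
Qed.

Let M1 := mx_expectation P (Xm i0).

(** The almost sure bound makes the entries integrable, and equality of laws gives every summand the
    mean of the first. *)
Lemma X_hasE i : mx_hasE P (Xm i) M1.
Proof.
have meas k := mxmeas_X X k.
have bnd k j l : {ae P, forall t, `|complex.Re (Xm k t j l)| <= L /\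
                                  `|complex.Im (Xm k t j l)| <= L}.
  apply: filterS (ae_bounded k) => t /Xspec[U [f [Uu -> fL]]].
  by apply: Re_Im_bound; [exact: ltW|exact: fcal_entry_bound].
have key (p : R[i] -> R) j l :
    measurable_fun setT (fun x : borel_mx R d => p ((x : 'M[R[i]]_d) j l)) ->
    (forall k, {ae P, forall t, `|p (Xm k t j l)| <= L}) ->
    hasE P (fun t => p (Xm i t j l)) (fine ('E_P[fun t => p (Xm i0 t j l)])).
  move=> mp pb.
  have mpk k : measurable_fun setT (fun t => p (Xm k t j l)).
    by apply: (measurableT_comp mp); exact: measurable_funPT.
  have hk k := hasE_bounded (mpk k) (pb k).
  suff -> : ('E_P[fun t => p (Xm i0 t j l)] = \int[P]_t (p (Xm i t j l))%:E)%E.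
    exact: hk.
  have mpE : measurable_fun setT
      (fun x : borel_mx R d => (p ((x : 'M[R[i]]_d) j l))%:E).
    exact/measurable_EFinP.
  rewrite unlock.
  rewrite -[LHS](integral_distribution mpE (proj1 (hk i0))).
  rewrite -[RHS](integral_distribution mpE (proj1 (hk i))).
  by apply: eq_measure_integral => A mA _; exact: idX.
move=> j l; have [mR mI] := mxmeas_id (R := R) (d := d) j l.
by rewrite mxE; split; apply: key => // k; apply: filterS (bnd k j l) => t [].
Qed.

(** An eigenvalue of the mean is its trace against the spectral projector [fcal V e], hence the
    expectation of a quantity that lies in [0, L] almost surely. *)
Lemma M1_spec : exists V mu, [/\ V \is unitarymx, M1 = fcal V mu &
  forall j, 0 <= mu j <= L].
Proof.
have M1h := mx_hasE_herm (Xherm i0) (X_hasE i0).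
have [V [mu [Vu ME]]] := spectral_decomposition M1h.
exists V, mu; split => // j.
pose e k : R := (k == j)%:R.
have rE (f : 'I_d -> R) : rtr (fcal V e *m fcal V f) = f j.
  rewrite (fcalM _ _ Vu) rtr_fcal// (bigD1 j)//= big1 => [|k kj].
    by rewrite /e eqxx mul1r addr0.
  by rewrite /e (negbTE kj) mul0r.
have h := hasE_rtr (fcal V e) (X_hasE i0).
rewrite ME rE in h.
have e0 k : 0 <= e k by rewrite /e ler0n.
apply/andP; split.
  apply: hasE_ae_ge0 h; apply: filterS (ae_bounded i0) => t /Xspec[U [f [Uu -> fL]]].
  by apply: rtr_fcal2_ge0 => // k; have /andP[] := fL k.
rewrite -subr_ge0; have h2 := hasED (hasE_cst P L) (hasEZ (-1) h).
rewrite mulN1r in h2; apply: hasE_ae_ge0 h2.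
apply: filterS (ae_bounded i0) => t /Xspec[U [f [Uu -> fL]]].
have -> : L + -1 * rtr (fcal V e *m fcal U f) =
          rtr (fcal V e *m fcal U (fun k => L - f k)).
  have -> : fcal U (fun k => L - f k) = (L%:C)%:M - fcal U f.
    by rewrite (fcalc L Uu) fcalB.
  rewrite mulmxBr rtrB mulN1r; congr (_ - _).
  by rewrite (fcalc L Vu) rE.
by apply: rtr_fcal2_ge0 => // k; rewrite subr_ge0; have /andP[] := fL k.
Qed.

(** The bound of [trexp_tangent] with base point E X is affine in X; its expectation replaces X by
    the mean, where K gives equality. *)
Lemma single_step th i H : H \is hermsymmx ->
  (\int[P]_t (trexp (H + th%:C *: Xm i t))%:E <=
   (trexp (H + (chord_slope th L)%:C *: M1))%:E)%E.
Proof.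
move=> Hh; have [V [mu [Vu ME muL]]] := M1_spec.
have [K KE KX] := trexp_tangent th L_gt0 Hh Vu muL.
rewrite -ME in KE; rewrite -KE.
have hh t : H + th%:C *: Xm i t \is hermsymmx := hermD Hh (hermZ _ (Xherm i t)).
apply: (@ae_le_hasE _ _ _ _ _
  (fun t => rtr (K *m (1%:M + (chord_slope th L)%:C *: Xm i t)))).
- apply: measurable_trexp => //; apply: mxmeasD; first exact: mxmeas_cst.
  by apply: mxmeasZ; exact: mxmeas_X.
- by move=> t; exact: trexp_ge0 (hh t).
- apply: filterS (ae_bounded i) => t /Xspec[U [f [Uu -> fL]]].
  exact: KX.
- have hX := hasED (hasE_cst P (rtr K))
    (hasEZ (chord_slope th L) (hasE_rtr K (X_hasE i))).
  have E A : rtr (K *m (1%:M + (chord_slope th L)%:C *: A)) =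
      rtr K + chord_slope th L * rtr (K *m A).
    by rewrite mulmxDr mulmx1 rtrD -scalemxAr rtrZ.
  by rewrite E; under eq_fun do rewrite E.
Qed.

Let S := mx_sum X.

Lemma ES_E : mx_expectation P S = (n%:R)%:C *: M1.
Proof.
apply: mx_hasE_expectation.
have -> : (n%:R)%:C *: M1 = \sum_(i < n) M1.
  rewrite sumr_const card_ord -(scaler_nat n M1).
  by congr (_ *: _); exact: rmorph_nat.
by apply: mx_hasE_sum => i; exact: X_hasE.
Qed.

Lemma Sherm t : S t \is hermsymmx.
Proof.
rewrite /S /mx_sum; elim/big_ind: _ => [|A B|i _]; first 1 last.
- exact: hermD.
- exact: Xherm.
- by apply/hermP; rewrite adjE trmx0 map_mx0.
Qed.

Lemma S_psd t U f : U \is unitarymx -> S t = fcal U f -> forall j, 0 <= f j.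
Proof.
move=> Uu SE; apply: (psdmx_eigen_ge0 Uu); rewrite -SE; split; first exact: Sherm.
move=> v; rewrite /S /mx_sum mulmx_sumr mulmx_suml summxE.
by apply: sumr_ge0 => i _; have [_ h] := psdX i t; exact: h.
Qed.

Lemma trexp_sum_le th :
  (\int[P]_t (trexp (th%:C *: S t))%:E <=
   (trexp ((n%:R * chord_slope th L)%:C *: M1))%:E)%E.
Proof.
have [V [mu [Vu ME muL]]] := M1_spec.
have Gh : (chord_slope th L)%:C *: M1 \is hermsymmx.
  by rewrite ME; exact: (hermZ _ (fcal_herm _ _)).
have h0 : (0 : 'M[R[i]]_d) \is hermsymmx.
  by apply/hermP; rewrite adjE trmx0 map_mx0.
have h := expectation_trexp_sum indepX Xherm Gh (@single_step th)
  (enum_uniq 'I_n) h0.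
rewrite size_enum_ord in h.
have -> : trexp ((n%:R * chord_slope th L)%:C *: M1) =
    trexp (0 + n%:R *: ((chord_slope th L)%:C *: M1)).
  by rewrite add0r scalerA -(rmorph_nat (real_complex R)) -rmorphM.
apply: le_trans h; rewrite le_eqVlt; apply/orP; left; apply/eqP.
apply: eq_integral => t _.
have -> : S t = seq_sum X (enum 'I_n) t by rewrite /seq_sum big_enum.
by rewrite add0r.
Qed.

(** The hypothesis on [E] says that some eigenvalue of sg S is at least c, in a form that makes [E]
    measurable. The signs sg = 1 and sg = -1 serve the largest and the smallest eigenvalue of S. *)
Lemma spectral_tail (sg th' c : R) (E : set T) : 0 <= th' ->
  (forall t, E t <-> forall k : nat,
     1 <= trexp ((k%:R)%:C *: (sg%:C *: S t - (c%:C)%:M))) ->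
  (P E <= (trexp ((n%:R * chord_slope (th' * sg) L)%:C *: M1)
           / expR (th' * c))%:E)%E.
Proof.
move=> th0 EE.
have mS : mxmeas S by apply: mxmeas_sum => i; exact: mxmeas_X.
have hS t : sg%:C *: S t \is hermsymmx := hermZ _ (Sherm t).
apply: (@chernoff_markov _ _ _ _ (fun t => trexp ((th' * sg)%:C *: S t))).
- have -> : E = \bigcap_(k : nat) [set t |
      1 <= trexp ((k%:R)%:C *: (sg%:C *: S t - (c%:C)%:M))].
    by apply/seteqP; split => t; rewrite EE => h k; [move=> _|]; exact: h.
  apply: bigcapT_measurable => k.
  have := measurable_trexp_shift k%:R c (mxmeasZ sg mS) hS.
  move=> /(_ measurableT [set` `[1, +oo[%R] (measurable_itv _)).
  rewrite setTI; congr measurable; apply/seteqP; split => x /=;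
    by rewrite in_itv/= andbT.
- by apply: measurable_trexp => [|t]; [exact: mxmeasZ|exact: (hermZ _ (Sherm t))].
- by move=> t; exact: trexp_ge0 (hermZ _ (Sherm t)).
- exact: expR_gt0.
(* One eigenvalue of sg S above c already contributes e^(th' c) to the trace. *)
- move=> t /EE; have [U [f [Uu SE]]] := spectral_decomposition (Sherm t).
  rewrite SE fcalZ => /(spectrum_ge_trexp _ _ Uu)[j cj].
  rewrite fcalZ trexp_fcal// (bigD1 j)//= -[leLHS]addr0 lerD//.
    by rewrite ler_expR -mulrA ler_wpM2l.
  by apply: sumr_ge0 => k _; exact: expR_ge0.
- exact: trexp_sum_le.
Qed.

End matrix_chernoff.

Section exponents.
Context {R : realType}.

Lemma expR_div_powR (e x : R) : 0 < x ->
  expR e / x `^ x = expR (e - x * ln x).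
Proof.
move=> x0; rewrite expRD expRN; congr (_ / _).
by rewrite -[X in X `^ _](lnK x0) -expRM mulrC.
Qed.

(** The exponential at hi is factored out; the remaining ratio e^(eps (lo - hi) / L) damps the other
    intrinsic dimension, with lo / hi in the role of 1 / kappa. *)
Lemma upper_exponent (up low hi lo L eps : R) : 0 < L -> 0 < hi -> 0 < eps ->
  (up * expR (eps / L * hi) + low * expR (eps / L * lo))
    / expR (ln (1 + eps) / L * ((1 + eps) * hi)) =
  (up + low * expR (- (eps * hi * (1 - (hi / lo)^-1) / L)))
    * (expR eps / (1 + eps) `^ (1 + eps)) `^ (hi / L).
Proof.
move=> L0 hi0 e0; rewrite expR_div_powR ?addr_gt0// -expRM -expRN !mulrDl.
rewrite -!mulrA -!expRD invf_div; congr (_ * expR _ + _ * expR _); field;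
  by rewrite ?gt_eqF.
Qed.

(** Here the exponential at lo dominates, because the slope - eps / L is negative. *)
Lemma lower_exponent (up low hi lo L eps : R) : 0 < L -> 0 < lo -> eps < 1 ->
  (up * expR (- eps / L * hi) + low * expR (- eps / L * lo))
    / expR (- (ln (1 - eps) / L) * (- ((1 - eps) * lo))) =
  (low + up * expR (- (eps * lo * (hi / lo - 1) / L)))
    * (expR (- eps) / (1 - eps) `^ (1 - eps)) `^ (lo / L).
Proof.
move=> L0 lo0 e1; rewrite expR_div_powR ?subr_gt0// -expRM -expRN !mulrDl addrC.
rewrite -!mulrA -!expRD; congr (_ * expR _ + _ * expR _); field;
  by rewrite ?gt_eqF.
Qed.

End exponents.

Theorem theoremB5 (disp : measure_display) (T : measurableType disp)
    (R : realType) (P : probability T R) (n d : nat) (n_gt0 : (0 < n)%N)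
    (X : 'I_n -> {RV P >-> borel_mx R d}) (L : R) :
  let X1 : T -> 'M[R[i]]_d := X (Ordinal n_gt0) in
  let S : T -> 'M[R[i]]_d := mx_sum X in
  let EX1 := mx_expectation P X1 in
  let ES := mx_expectation P S in
  (forall i t, psdmx (X i t)) ->
  mutually_independent X ->
  identically_distributed X ->
  0 < L ->
  {ae P, forall t, loewner_le 0 (X1 t) /\ loewner_le (X1 t) (L%:C)%:M} ->
  0 < lambda_min ES ->
  ~ (exists c : R[i], ES = c%:M) ->
  let kappa := opnorm ES / lambda_min ES in
  forall eps : R, 0 < eps -> eps < 1 ->
  let d_min := lower_dim ES + upper_dim ES *
    expR (- (n%:R * eps * lambda_min EX1 * (kappa - 1) / L)) in
  let d_max := upper_dim ES + lower_dim ES *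
    expR (- (n%:R * eps * opnorm EX1 * (1 - kappa^-1) / L)) in
  (P [set t | (lambda_min (S t) <= (1 - eps) * lambda_min ES)%R] <=
   (d_min * (expR (- eps) / (1 - eps) `^ (1 - eps))
              `^ (n%:R * lambda_min EX1 / L))%:E)%E
  /\
  (P [set t | ((1 + eps) * opnorm ES <= opnorm (S t))%R] <=
   (d_max * (expR eps / (1 + eps) `^ (1 + eps))
              `^ (n%:R * opnorm EX1 / L))%:E)%E.
Proof.
move=> X1 S EX1 ES psdX indepX idX L0 aeX0 lo_gt0 nonscalar kappa eps e0 e1 d_min d_max.
have aeX : {ae P, forall t, loewner_le (X1 t) (L%:C)%:M}.
  by apply: filterS aeX0 => t [].
have [V [mu [Vu ME muL]]] := M1_spec psdX idX L0 aeX.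
have ESE := ES_E psdX idX L0 aeX.
rewrite -/S -/ES in ESE; rewrite -/X1 -/EX1 in ME ESE.
pose f j := n%:R * mu j.
have ESf : ES = fcal V f by rewrite ESE ME fcalZ.
have f0 j : 0 <= f j by rewrite mulr_ge0//; have /andP[] := muL j.
(* In dimension 0 there is no eigenvalue, and the infimum of the empty set is 0, against
   [lo_gt0]. *)
have [d0|d0] := posnP d.
  suff l0 : lambda_min ES = 0 by move: lo_gt0; rewrite l0 ltxx.
  rewrite /lambda_min (_ : [set x | _] = set0) ?inf0//.
  apply/seteqP; split => // x /= /eigenvalueP[v _ /negP[]].
  by apply/eqP/rowP => j; have := ltn_ord j; rewrite {2}d0.
pose j0 := Ordinal d0.
have [jlo loE lo_le] := lambda_min_fcal f j0 Vu.
have [jhi hiE hi_ge] := opnorm_fcal j0 Vu f0.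
rewrite -ESf in loE hiE.
have n0 : 0 < n%:R :> R by rewrite ltr0n.
have loE1 : n%:R * lambda_min EX1 = lambda_min ES.
  rewrite ME loE; have [j -> jmin] := lambda_min_fcal mu j0 Vu.
  by apply/le_anti; rewrite lo_le ler_wpM2l// ltW.
have hiE1 : n%:R * opnorm EX1 = opnorm ES.
  have mu0 j : 0 <= mu j by have /andP[] := muL j.
  rewrite ME hiE; have [j -> jmax] := opnorm_fcal j0 Vu mu0.
  by apply/le_anti; rewrite hi_ge ler_wpM2l// ltW.
set lo := lambda_min ES in lo_gt0 loE loE1 *.
set hi := opnorm ES in hiE hiE1 *.
(* Equality would force a constant spectrum, hence a scalar mean. *)
have lohi : lo < hi.
  rewrite lt_neqAle loE hiE lo_le andbT; apply/eqP => flh.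
  apply: nonscalar; exists (f jlo)%:C; rewrite ESf.
  apply: (scalar_of_const_spectrum Vu) => j.
  by apply/le_anti; rewrite lo_le flh hi_ge.
have fb j : lo <= f j <= hi by rewrite loE hiE lo_le hi_ge.
have hi_gt0 := lt_trans lo_gt0 lohi.
have bound k : trexp (k%:C *: ES) <=
    upper_dim ES * expR (k * hi) + lower_dim ES * expR (k * lo).
  by rewrite ESf; apply: trexp_intrinsic_dim; rewrite -?ESf.
have Sspec t : exists U g, [/\ U \is unitarymx, S t = fcal U g & forall j, 0 <= g j].
  have [U [g [Uu SE]]] := spectral_decomposition (Sherm psdX t).
  by exists U, g; split => //; exact: (S_psd psdX Uu SE).
have nchord th : (n%:R * chord_slope th L)%:C *: EX1 = (chord_slope th L)%:C *: ES.
  by rewrite ESE scalerA -rmorphM mulrC.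
split.
  (* The lower tail concerns the largest eigenvalue of - S, so th' is nonnegative while th = - th' =
     ln(1 - eps) / L. *)
  have tail := spectral_tail psdX indepX idX L0 aeX (sg := -1)
    (th' := - (ln (1 - eps) / L)) (c := - ((1 - eps) * lo)) _ _.
  have th0 : 0 <= - (ln (1 - eps) / L).
    rewrite -mulNr divr_ge0 ?(ltW L0)// oppr_ge0.
    by rewrite ln_le0// gerBl ltW.
  apply: le_trans (tail _ th0 _) _.
    move=> t /=; have [U [g [Uu SE g0]]] := Sspec t.
    rewrite -/S SE fcalZ (spectrum_ge_trexp _ _ Uu).
    have [j -> jmin] := lambda_min_fcal g j0 Uu; split.
      by move=> h; exists j; rewrite mulN1r lerN2.
    by move=> [k]; rewrite mulN1r lerN2; apply: le_trans.
  rewrite -/X1 -/EX1 nchord lee_fin.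
  have -> : chord_slope (- (ln (1 - eps) / L) * -1) L = - eps / L.
    rewrite /chord_slope mulrN1 opprK divfK ?gt_eqF// lnK ?posrE ?subr_gt0//.
    by congr (_ / _); rewrite addrAC subrr sub0r.
  apply: le_trans (_ : _ <= _) _.
    by apply: ler_wpM2r (bound _); rewrite invr_ge0 expR_ge0.
  rewrite lower_exponent// /d_min /kappa -/hi -/lo loE1.
  by rewrite [n%:R * eps * _]mulrAC loE1 (mulrC lo eps).
(* S is positive semidefinite, so its norm reaches the threshold exactly when some eigenvalue
   does. *)
have tail := spectral_tail psdX indepX idX L0 aeX (sg := 1)
  (th' := ln (1 + eps) / L) (c := (1 + eps) * hi) _ _.
have th0 : 0 <= ln (1 + eps) / L.
  by rewrite divr_ge0 ?(ltW L0)// ln_ge0// lerDl ltW.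
apply: le_trans (tail _ th0 _) _.
  move=> t /=; have [U [g [Uu SE g0]]] := Sspec t.
  rewrite -/S SE fcalZ (spectrum_ge_trexp _ _ Uu).
  have [j -> jmax] := opnorm_fcal j0 Uu g0; split.
    by move=> h; exists j; rewrite mul1r.
  by move=> [k]; rewrite mul1r => h; apply: (le_trans h).
rewrite -/X1 -/EX1 nchord lee_fin.
have -> : chord_slope (ln (1 + eps) / L * 1) L = eps / L.
  rewrite /chord_slope mulr1 divfK ?gt_eqF// lnK ?posrE ?addr_gt0//.
  by congr (_ / _); rewrite addrAC subrr add0r.
apply: le_trans (_ : _ <= _) _.
  by apply: ler_wpM2r (bound _); rewrite invr_ge0 expR_ge0.
rewrite upper_exponent// /d_max /kappa -/hi -/lo hiE1.
by rewrite [n%:R * eps * _]mulrAC hiE1 (mulrC hi eps).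
Qed.
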